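(* Let $G$ be a (Hausdorff) topological group possessing a basis of open neighborhoods of the identity consisting of open subgroups. If $G$ is amenable (as a topological group), then ${G^*}^{00}_{\mathrm{top}}={G^*}^{000}_{\mathrm{top}}$.
   Context: A topological group $G$ is amenable if for every continuous action of $G$ on a nonempty compact Hausdorff space $X$ there is a $G$-invariant Borel probability measure on $X$. Regard $G$ as a group $\emptyset$-definable in a first order structure $M$ whose language contains predicates for all open subsets of $G$ (e.g. $M$ is $G$ with the group operation and these predicates; the objects below do not depend on the choice of such a language). Let $\mathfrak C\succ M$ be a monster model ($\kappa$-saturated and strongly $\kappa$-homogeneous for a sufficiently large strong limit cardinal $\kappa$), let $G^*$ be the interpretation of $G$ in $\mathfrak C$, and for open $U\subseteq G$ let $U^*$ be its interpretation. ''Bounded index'' means index $<\kappa$. Let $\mu=\bigcap\{U^*: U\text{ an open neighborhood of }e\text{ in }G\}$. ${G^*}^{00}_{\mathrm{top}}$ is the smallest bounded index subgroup of $G^*$ which is an intersection of some sets of the form $U^*$ for $U$ open in $G$. ${G^*}^{000}_{\mathrm{top}}$ is the smallest normal, bounded index subgroup of $G^*$ which is invariant under $\mathrm{Aut}(\mathfrak C/M)$ and contains $\mu$. *)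

(* Defs.v *)
From HB Require Import structures.
From mathcomp Require Import all_boot all_order all_algebra.
From mathcomp Require Import all_classical all_reals all_analysis.

Set Implicit Arguments.
Unset Strict Implicit.
Unset Printing Implicit Defensive.

Local Open Scope classical_set_scope.
Local Open Scope card_scope.

HB.mixin Record isTopologicalGroup G & Topological G & Group G := {
  mulg_continuous : continuous (fun x : G * G => (x.1 * x.2)%g);
  invg_continuous : continuous (fun x : G => (x^-1)%g)
}.

#[short(type="topologicalGroupType")]
HB.structure Definition TopologicalGroup :=
  {G of Topological G & Group G & isTopologicalGroup G}.

Definition has_open_subgroup_basis (G : topologicalGroupType) : Prop :=
  forall U : set G, nbhs 1%g U ->
    exists H : set G, [/\ open H, group_closed [in H] & H `<=` U].

Definition is_continuous_action (G : topologicalGroupType)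
    (X : topologicalType) (act : G -> X -> X) : Prop :=
  [/\ forall x, act 1%g x = x,
      forall g h x, act (g * h)%g x = act g (act h x)
    & continuous (fun p : G * X => act p.1 p.2)].

(* A [ptopologicalType] is a topological space with a chosen point, that is,
   a nonempty one; no compatibility of the action with the point is asked. *)
Definition amenable (R : realType) (G : topologicalGroupType) : Prop :=
  forall (X : ptopologicalType) (act : G -> X -> X),
    compact [set: X] -> hausdorff_space X -> is_continuous_action act ->
    exists P : probability (g_sigma_algebraType (@open X)) R,
      forall g (A : set X), <<s @open X >> A -> P (act g @^-1` A) = P A.

(* A cardinal is represented by a type of that cardinality. *)

Definition card_lt (T U : Type) (A : set T) (B : set U) : Prop :=
  A #<= B /\ ~ (B #<= A).

Notation "A '#<' B" := (card_lt A B) (at level 79) : card_scope.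

(* Every cardinal below [K] is the cardinality of a subset of [K]. *)
Definition uncountable_strong_limit (K : Type) : Prop :=
  [set: nat] #< [set: K] /\
  forall A : set K, A #< [set: K] -> [set B | B `<=` A] #< [set: K].

Record language := Language {
  funsym : nat -> Type;
  relsym : nat -> Type
}.

Inductive term (L : language) (V : Type) : Type :=
| TVar of V
| TFunc n of funsym L n & ('I_n -> term L V).

(* Formulas whose free variables are indexed by [V]; the variable bound by
   [FAll] is [None]. *)
Inductive formula (L : language) (V : Type) : Type :=
| FEq of term L V & term L V
| FRel n of relsym L n & ('I_n -> term L V)
| FFalse
| FImp of formula L V & formula L V
| FAll of formula L (option V).

Record structure (L : language) := Structure {
  carrier :> Type;
  ifunc : forall n, funsym L n -> ('I_n -> carrier) -> carrier;
  irel : forall n, relsym L n -> set ('I_n -> carrier)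
}.

Fixpoint eval L (M : structure L) (V : Type) (v : V -> M) (t : term L V) : M :=
  match t with
  | TVar x => v x
  | TFunc _ f ts => ifunc f (fun i => eval v (ts i))
  end.

Fixpoint sat L (M : structure L) (V : Type) (phi : formula L V) : (V -> M) -> Prop :=
  match phi with
  | FEq t u => fun v => eval v t = eval v u
  | FRel _ r ts => fun v => irel r (fun i => eval v (ts i))
  | FFalse => fun _ => False
  | FImp phi1 phi2 => fun v => sat phi1 v -> sat phi2 v
  | FAll phi1 => fun v => forall a : M, sat phi1 (oapp v a)
  end.

Definition elementary_embedding L (M C : structure L) (j : M -> C) : Prop :=
  forall (V : Type) (phi : formula L V) (v : V -> M), sat phi (j \o v) <-> sat phi v.

Definition automorphism L (C : structure L) (s : C -> C) : Prop :=
  [/\ bijective s,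
      forall n (f : funsym L n) a, s (ifunc f a) = ifunc f (s \o a)
    & forall n (r : relsym L n) a, irel r (s \o a) <-> irel r a].

(* A formula in one variable with parameters in [A] is a formula whose
   variables are indexed by [option A]: [Some a] is interpreted as [a], and
   [None] is the variable. *)
Definition saturated (K : Type) L (C : structure L) : Prop :=
  forall A : set C, A #< [set: K] ->
  forall p : set (formula L (option A)),
    (forall q : set (formula L (option A)), q `<=` p -> finite_set q ->
       exists b : C, forall phi, q phi -> sat phi (oapp \val b)) ->
    exists b : C, forall phi, p phi -> sat phi (oapp \val b).

Definition strongly_homogeneous (K : Type) L (C : structure L) : Prop :=
  forall A : set C, A #< [set: K] ->
  forall f : A -> C,
    (forall phi : formula L A, sat phi f <-> sat phi \val) ->
    exists2 s : C -> C, automorphism s & forall a : A, s (\val a) = f a.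

(* [C], with [M] embedded by [j], is a monster model of degree [K]; [K] is
   sufficiently large when it exceeds the cardinalities of [M] and [L]. *)
Record monster (K : Type) L (M C : structure L) (j : M -> C) : Prop := Monster {
  monster_strong_limit : uncountable_strong_limit K;
  monster_func : [set: {n & funsym L n}] #< [set: K];
  monster_rel : [set: {n & relsym L n}] #< [set: K];
  monster_model : [set: M] #< [set: K];
  monster_elementary : elementary_embedding j;
  monster_saturated : saturated K C;
  monster_homogeneous : strongly_homogeneous K C
}.

Definition val3 (I T : Type) (a b c : I -> T) (x : I + I + I) : T :=
  match x with
  | inl (inl i) => a i
  | inl (inr i) => b i
  | inr i => c i
  end.

(* [G] is identified through [gemb] with a subset of [M ^ gdim]. The value of
   [gpred] on sets that are not open is irrelevant. *)
Record definable_group L (M : structure L) (G : topologicalGroupType) :=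
DefinableGroup {
  gdim : nat;
  gemb : G -> 'I_gdim -> M;
  gemb_inj : injective gemb;
  gdom : formula L 'I_gdim;
  gdomP : forall a, sat gdom a <-> exists g, a = gemb g;
  gmul : formula L ('I_gdim + 'I_gdim + 'I_gdim);
  gmulP : forall a b c, sat gmul (val3 a b c) <->
    exists g h, [/\ a = gemb g, b = gemb h & c = gemb (g * h)%g];
  gpred : set G -> relsym L gdim;
  gpredP : forall U : set G, open U ->
    forall a, irel (gpred U) a <-> exists2 g, U g & a = gemb g
}.

Arguments gemb {L M G} d _ _.

Section Star.
Variables (L : language) (M : structure L) (G : topologicalGroupType).
Variables (D : definable_group M G) (K : Type) (C : structure L) (j : M -> C).

Local Notation tuples := ('I_(gdim D) -> C).

Implicit Types (a b c h : tuples) (H : set tuples) (U : set G).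

Definition Gstar : set tuples := [set a | sat (gdom D) a].

Definition star U : set tuples := irel (gpred D U).

Definition star_one : tuples := j \o gemb D 1%g.

Definition star_mul a b c : Prop := sat (gmul D) (val3 a b c).

Definition star_subgroup H : Prop :=
  [/\ H `<=` Gstar,
      H star_one,
      forall a b c, H a -> H b -> star_mul a b c -> H c
    & forall a b, H a -> star_mul a b star_one -> H b].

Definition star_lcoset a H : set tuples :=
  [set c | exists2 h, H h & star_mul a h c].

Definition star_rcoset H a : set tuples :=
  [set c | exists2 h, H h & star_mul h a c].

Definition star_normal H : Prop :=
  forall a, Gstar a -> star_lcoset a H = star_rcoset H a.

Definition bounded_index H : Prop :=
  [set star_lcoset a H | a in Gstar] #< [set: K].

Definition invariant_over_model H : Prop :=
  forall s : C -> C, automorphism s -> (forall m : M, s (j m) = j m) ->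
    forall a, H (s \o a) <-> H a.

Definition star_mu : set tuples :=
  \bigcap_(U in [set U | open U /\ U 1%g]) star U.

Definition intersection_of_opens H : Prop :=
  exists2 F : set (set G), F `<=` open & H = \bigcap_(U in F) star U.

(* [smallest P A] is the intersection of all the sets that satisfy [P] and
   contain [A]. *)
Definition G00top : set tuples :=
  smallest
    (fun H => [/\ star_subgroup H, bounded_index H & intersection_of_opens H])
    set0.

Definition G000top : set tuples :=
  smallest
    (fun H => [/\ star_subgroup H, star_normal H, bounded_index H
                & invariant_over_model H])
    star_mu.

End Star.

Arguments G00top {L M G} D K {C} j.
Arguments G000top {L M G} D K {C} j.

(* Main.v *)
Require Import Defs.
From HB Require Import structures.
From mathcomp Require Import all_boot all_order all_algebra.
From mathcomp Require Import all_classical all_reals all_analysis.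
From mathcomp Require Import lra.

(** Both components are compared through the subgroups that define them, in
    the group of points [gpoint] of the monster model.

    The basic tool is the coheir: an ultrafilter on [G] defines a global type
    that is invariant over [M]. If [H] is an invariant subgroup of bounded
    index, a coheir over a point [a] of which the ultrafilter extends the type
    is in the coset of [a] ([coheir_coset]); hence points of the same type over
    [M] are in the same coset of [H] ([same_type_coset]).

    One inclusion needs only this. Let [H] be a bounded index subgroup that is
    an intersection of stars of open sets. It contains the infinitesimals, but
    need not be normal. If [v] is infinitesimal and [a] is any point, a coheir
    [c] over both is in the coset of [a]; moreover the conjugate of [v] by [c]
    is in [H], since this is so for the conjugates by elements of [G]. Hence
    [H] contains the conjugates of [v] ([conj_infinitesimal]) and the normal
    core of [H] is one of the subgroups that define the other component
    ([G000top_sub]).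

    The other inclusion uses amenability. The sets [X] that are invariant under
    left multiplication by an open subgroup form a Boolean algebra of open
    sets. The action of [G] on its Stone space is continuous, so that
    amenability yields a finitely additive left invariant mean on the algebra
    ([amenable_mean]). An argument of Massicot and Wagner, adapted from
    Sanders, shows that if [X] has positive mean then [X X (X X)^-1] contains
    a member of the algebra that is symmetric and generic (finitely many of its
    translates cover [G]), and that contains the square of a smaller set of the
    same kind, and so on ([massicot_wagner], [generic_chain]). The
    stars of a chain of such sets intersect in a bounded index subgroup
    ([G00top_chain]), so that the smallest one is contained in the star of
    [X X (X X)^-1]. Let now [X] range over an ultrafilter [p] of sets of
    positive mean: by compactness every element of the smallest intersection of
    stars is of the form [x1 x2 (x3 x4)^-1], where each [xi] is in the stars of
    all the members of [p]. Because [G] has a basis of open subgroups, two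
    points that belong to the stars of the same members of the algebra have,
    up to an infinitesimal factor, the same type over [M]
    ([lunif_type_infinitesimal]). Hence the [xi] are in a single coset of any
    normal invariant subgroup of bounded index that contains the
    infinitesimals, and such a subgroup contains [x1 x2 (x3 x4)^-1]
    ([G00top_sub]). *)

Set Implicit Arguments.
Unset Strict Implicit.
Unset Printing Implicit Defensive.

Import Order.TTheory GRing.Theory Num.Theory.
Local Open Scope classical_set_scope.
Local Open Scope card_scope.

(** * Small cardinals *)

Lemma card_leTP (T U : Type) :
  [set: T] #<= [set: U] <-> exists f : T -> U, injective f.
Proof.
split=> [/card_leP[f]|[f finj]].
  exists (fun x => val (f (SigSub (mem_set (I : setT x))))) => x y.
  by move=> /val_inj/(@inj _ _ _ f); rewrite !inE => /(_ I I)[].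
rewrite -(card_le_eql (inj_card_eq (A := [set: T]) (f := f) _)).
  exact: card_leT.
by move=> x y _ _; apply: finj.
Qed.

(** A maximal graph of a partial injection from [T] to [U] is total or
    surjective. *)
Lemma card_comparable (T U : Type) :
  (exists f : T -> U, injective f) \/ (exists f : U -> T, injective f).
Proof.
pose inj_graph (A : set (T * U)) := forall p q, A p -> A q ->
  (p.1 = q.1 <-> p.2 = q.2).
have [|A [Aok Amax]] := @Zorn_bigcup (T * U)%type inj_graph.
  move=> F Fok Ftot p q [A FA Ap] [B FB Bq].
  have [AB|BA] := Ftot A B FA FB.
    exact: Fok FB _ _ (AB _ Ap) Bq.
  exact: Fok FA _ _ Ap (BA _ Bq).
have [dom|/existsNP[x xA]] := pselect (forall x, exists y, A (x, y)).
  left; have [f fA] := choice dom; exists f => x y fxy.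
  exact: (Aok _ _ (fA x) (fA y)).2.
have [cod|/existsNP[y yA]] := pselect (forall y, exists x, A (x, y)).
  right; have [f fA] := choice cod; exists f => y z fyz.
  exact: (Aok _ _ (fA y) (fA z)).1.
have /Amax : A `<` A `|` [set (x, y)].
  split=> [p|/(_ (x, y))]; first by left.
  by move=> /(_ (or_intror erefl)) Axy; apply: xA; exists y.
case=> p q [Ap|->] [Aq|->] /=; first exact: Aok.
- split=> E; exfalso; [apply: xA; exists p.2|apply: yA; exists p.1].
    by rewrite -E -surjective_pairing.
  by rewrite -E -surjective_pairing.
- split=> E; exfalso; [apply: xA; exists q.2|apply: yA; exists q.1].
    by rewrite E -surjective_pairing.
  by rewrite E -surjective_pairing.
- by [].
Qed.

Section Small.
Variable K : Type.
Hypothesis limK : uncountable_strong_limit K.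

Definition small (T : Type) := [set: T] #< [set: K].

Lemma smallP (T : Type) :
  small T <-> ~ exists f : K -> T, injective f.
Proof.
split=> [[_ nKT] /card_leTP//|nKT]; split; last by rewrite card_leTP.
by rewrite card_leTP; have [|/nKT] := card_comparable T K.
Qed.

Lemma small_inj (T U : Type) (f : T -> U) : injective f -> small U -> small T.
Proof.
move=> finj; rewrite !smallP => nKU [g ginj]; apply: nKU.
by exists (f \o g); apply: inj_comp.
Qed.

Lemma small_surj (T U : Type) (f : T -> U) :
  (forall y, exists x, f x = y) -> small T -> small U.
Proof.
move=> /choice[g fg]; apply: (@small_inj _ _ g) => y z gyz.
by rewrite -(fg y) gyz fg.
Qed.

Lemma small_setP (T : Type) (A : set T) : A #< [set: K] <-> small A.
Proof.
rewrite /small /card_lt.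
by rewrite (card_le_eql (card_setT A)) (card_le_eqr (card_setT A)).
Qed.

Lemma small_nat : small nat. Proof. exact: limK.1. Qed.

Lemma small_set (T : Type) : small T -> small (set T).
Proof.
move=> sT; have /card_leTP[f finj] := sT.1.
have fT : small (range f).
  apply: (@small_surj _ _ (fun x => SigSub (mem_set (imageT f x)))) sT => -[y yP].
  by have [x _ xy] := set_mem yP; exists x; apply/val_inj.
have := limK.2 (range f); rewrite !small_setP => /(_ fT).
have fB (B : set T) : [set B | B `<=` range f] (f @` B) by move=> _ [x _ <-]; exists x.
apply: (@small_inj _ _ (fun B => SigSub (mem_set (fB B)))) => B1 B2 [] E.
apply/seteqP; split=> x Bx.
  by have : (f @` B2) (f x); [rewrite -E; exists x|case=> y By /finj <-].
by have : (f @` B1) (f x); [rewrite E; exists x|case=> y By /finj <-].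
Qed.

(** Kuratowski pairs embed the square of [T] in its second power set. *)
Lemma small_sqr (T : Type) : small T -> small (T * T).
Proof.
move=> /small_set/small_set.
apply: (@small_inj _ _ (fun p A => A = [set p.1] \/ A = [set p.1; p.2])).
case=> x y [x' y'] /= E; have {}E A := congr1 (@^~ A) E.
have xx : x' = x.
  have : [set x] = [set x] \/ [set x] = [set x; y] by left.
  by rewrite E => -[] /seteqP[_ /(_ x')]; apply; [|left].
move: E; rewrite xx => E.
have yP : y = x \/ y = y'.
  have : [set x; y] = [set x] \/ [set x; y] = [set x; y] by right.
  by rewrite E => -[] /seteqP[/(_ y) H _]; have := H (or_intror erefl); [left|].
have y'P : y' = x \/ y' = y.
  have : [set x; y'] = [set x] \/ [set x; y'] = [set x; y'] by right.
  by rewrite -E => -[] /seteqP[/(_ y') H _]; have := H (or_intror erefl); [left|].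
by congr (_, _); case: yP => // yx; case: y'P => [->|].
Qed.

Lemma small_sum (T U : Type) : small T -> small U -> small (T + U).
Proof.
wlog: T U / exists f : T -> U, injective f.
  move=> H sT sU; have [le|le] := card_comparable T U; first exact: H.
  apply: (@small_inj _ (U + T)
    (fun x => match x with inl a => inr a | inr b => inl b end)).
    by case=> a [b|b] // [->].
  exact: H.
move=> [f finj] sT sU.
(* Two points of [U] serve as tags for the two summands. *)
have [[a [b ab]]|nU] := pselect (exists a b : U, a <> b); last first.
  have Ueq (a b : U) : a = b by apply: contrapT => ab; apply: nU; exists a, b.
  apply: (@small_inj _ nat
    (fun x => match x with inl _ => 0 | inr _ => 1 end)).
    by case=> x [y|y] // _; congr (_ _); [apply: finj|]; apply: Ueq.
  exact: small_nat.
apply: (@small_inj _ _ (fun x =>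
  match x with inl x => (a, f x) | inr y => (b, y) end)) (small_sqr sU).
by case=> x [y|y] // [] => [/finj->|/ab|/esym/ab|->].
Qed.

Lemma small_prod (T U : Type) : small T -> small U -> small (T * U).
Proof.
move=> sT sU.
apply: (@small_inj _ _ (fun p => (inl p.1, inr p.2)))
  (small_sqr (small_sum sT sU)).
by case=> x y [x' y'] /= [-> ->].
Qed.

Lemma small_ord n : small 'I_n.
Proof. exact: small_inj val_inj small_nat. Qed.

Lemma small_fun (I T : Type) : small I -> small T -> small (I -> T).
Proof.
move=> sI sT.
apply: (@small_inj _ _ (fun f p => f p.1 = p.2))
  (small_set (small_prod sI sT)).
move=> f g E; apply/funext => i.
by have /= -> := congr1 (@^~ (i, g i)) E.
Qed.

Lemma small_unit : small unit.
Proof. by apply: (@small_inj _ _ (fun=> 0)) small_nat => -[] []. Qed.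

Lemma small_option (T : Type) : small T -> small (option T).
Proof.
move=> sT.
apply: (@small_inj _ _ (fun x => if x is Some y then inr y else inl tt))
  (small_sum small_unit sT).
by case=> [x|] [y|] // [->].
Qed.

End Small.

(** * First-order formulas *)

Section Renaming.
Variable L : language.

Fixpoint tren (V W : Type) (f : V -> W) (t : term L V) : term L W :=
  match t with
  | TVar x => TVar L (f x)
  | TFunc _ g ts => TFunc g (fun i => tren f (ts i))
  end.

Fixpoint fren (V : Type) (phi : formula L V) :
    forall W, (V -> W) -> formula L W :=
  match phi with
  | FEq t u => fun W f => FEq (tren f t) (tren f u)
  | FRel _ r ts => fun W f => FRel r (fun i => tren f (ts i))
  | FFalse => fun W f => FFalse L W
  | FImp phi1 phi2 => fun W f => FImp (fren phi1 f) (fren phi2 f)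
  | FAll phi1 => fun W f => FAll (fren phi1 (omap f))
  end.

Definition FNot V (phi : formula L V) := FImp phi (FFalse L V).
Definition FAnd V (phi psi : formula L V) := FNot (FImp phi (FNot psi)).
Definition FEx V (phi : formula L (option V)) := FNot (FAll (FNot phi)).

Definition sumf (A B T : Type) (f : A -> T) (g : B -> T) (x : A + B) : T :=
  match x with inl a => f a | inr b => g b end.

(** The elements of a definable group are tuples, so that a quantifier over
    the group is a block of quantifiers over the structure. *)
Fixpoint FAllI n : forall W, formula L (W + 'I_n) -> formula L W :=
  match n with
  | 0 => fun W phi => fren phi
      (fun x => match x with
         | inl w => w
         | inr (Ordinal _ lt) => match notF lt with end
         end)
  | n'.+1 => fun W phi => FAllI (FAll (fren phi
      (fun x : W + 'I_n'.+1 => match x with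
         | inl w => Some (inl w)
         | inr i => omap inr (unlift ord0 i)
         end)))
  end.

Variable N : structure L.

Lemma eval_tren V W (f : V -> W) (t : term L V) (w : W -> N) :
  Defs.eval w (tren f t) = Defs.eval (w \o f) t.
Proof. by elim: t => //= n g ts IH; congr ifunc; apply/funext => i. Qed.

Lemma sat_fren V (phi : formula L V) W (f : V -> W) (w : W -> N) :
  sat (fren phi f) w = sat phi (w \o f).
Proof.
elim: phi W f w => {V} [V t u|V n r ts|V|V phi1 IH1 phi2 IH2|V phi IH] W f w //=.
- by rewrite !eval_tren.
- by congr irel; apply/funext => i; rewrite eval_tren.
- by rewrite IH1 IH2.
- have oappE a : oapp w a \o omap f = oapp (w \o f) a by apply/funext; case.
  by apply/propext; split=> H a; move: (H a); rewrite IH oappE.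
Qed.

Lemma sat_and V (phi psi : formula L V) (v : V -> N) :
  sat (FAnd phi psi) v = (sat phi v /\ sat psi v).
Proof.
apply/propext => /=; split=> [H|[? ?] /(_ _) //]; last by apply.
by split; apply: contrapT => n; apply: H.
Qed.

Lemma sat_ex V (phi : formula L (option V)) (v : V -> N) :
  sat (FEx phi) v = exists a, sat phi (oapp v a).
Proof.
apply/propext => /=; split=> [H|[a Ha] /(_ a)//].
by apply: contrapT => n; apply: H => a Ha; apply: n; exists a.
Qed.

Lemma sat_alli n W (phi : formula L (W + 'I_n)) (v : W -> N) :
  sat (FAllI phi) v = forall a, sat phi (sumf v a).
Proof.
elim: n W phi v => [|n IH] W phi v.
  rewrite /= sat_fren; set f := _ \o _.
  have E a : f = sumf v a by apply/funext => -[//|[]].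
  apply/propext; split=> [H a|H]; first by rewrite -E.
  have a : 'I_0 -> N by case.
  by rewrite (E a).
rewrite [FAllI _]/= IH; apply/propext; split=> H a.
  have /= /(_ (a ord0)) := H (a \o lift ord0); rewrite sat_fren; congr sat.
  by apply/funext => -[//|i] /=; case: unliftP => [k|] ->.
move=> /= b; rewrite sat_fren.
pose c i := if unlift ord0 i is Some k then a k else b.
move: (H c); congr sat.
by apply/funext => -[//|i] /=; rewrite /c; case: unliftP.
Qed.

End Renaming.

(** Elementarity transfers the validity of formulas in finitely many
    variables, since these can be closed by universal quantifiers. *)
Lemma transfer_valid L (M C : structure L) (j : M -> C) (I : finType)
    (phi : formula L I) : elementary_embedding j ->
  (forall v : I -> M, sat phi v) -> forall v : I -> C, sat phi v.
Proof.
move=> elj H v.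
pose psi := FAllI (fren phi (fun i => inr (enum_rank i) : void + 'I_#|I|)).
have e : void -> M by case.
have : sat psi (j \o e).
  by apply/elj; rewrite /psi sat_alli => a; rewrite sat_fren.
rewrite /psi sat_alli => /(_ (v \o enum_val)); rewrite sat_fren; congr sat.
by apply/funext => i /=; rewrite enum_rankK.
Qed.

(** * Compactness and homogeneity of the monster model *)

Section Monster.
Variables (K : Type) (L : language) (C : structure L).
Hypothesis limK : uncountable_strong_limit K.

(** For sets of formulas that are directed by implication, finite
    satisfiability amounts to satisfiability of each element; this avoids
    conjunctions over finite sets. *)
Definition directed_type V (v : V -> C) I (p : set (formula L (I + V))) :=
  p !=set0 /\ forall phi psi, p phi -> p psi -> exists2 chi, p chi &
    forall a, sat chi (sumf a v) -> sat phi (sumf a v) /\ sat psi (sumf a v).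

Section Saturation.
Hypothesis satC : saturated K C.

Lemma saturated1 V (v : V -> C) (p : set (formula L (option V))) :
  small K V -> p !=set0 ->
  (forall phi psi, p phi -> p psi -> exists2 chi, p chi &
    forall b, sat chi (oapp v b) -> sat phi (oapp v b) /\ sat psi (oapp v b)) ->
  (forall phi, p phi -> exists b, sat phi (oapp v b)) ->
  exists b, forall phi, p phi -> sat phi (oapp v b).
Proof.
move=> sV [phi0 p0] pdir psat.
pose h x : range v := SigSub (mem_set (imageT v x)).
have sA : range v #< [set: K].
  rewrite small_setP; apply: (@small_surj _ _ _ h) sV => -[y yP].
  by have [x _ xy] := set_mem yP; exists x; apply/val_inj.
have renE phi b : sat (fren phi (omap h)) (oapp \val b) = sat phi (oapp v b).
  by rewrite sat_fren; congr sat; apply/funext; case.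
have [|b bP] := satC sA (p := [set fren phi (omap h) | phi in p]).
  move=> q qp /(@finite_seqP {classic _}) [s qs].
  suff [chi pchi chiP] : exists2 chi, p chi &
      forall b, sat chi (oapp v b) -> forall phi, phi \in s -> sat phi (oapp \val b).
    have [b bP] := psat chi pchi; exists b => phi; rewrite qs; exact: chiP.
  have {qs} : forall phi, phi \in s -> q phi by rewrite qs.
  elim: s => [|phi s IH] sq; first by exists phi0.
  have [psi psq|chi pchi chiP] := IH; first by apply: sq; rewrite inE psq orbT.
  have [psi ppsi psiE] := qp _ (sq phi (mem_head _ _)).
  have [chi' pchi' chiP'] := pdir _ _ pchi ppsi.
  exists chi' => // b /chiP'[/chiP H1 H2] th; rewrite inE => /orP[/eqP->|/H1//].
  by rewrite -psiE renE.
by exists b => phi pphi; rewrite -renE; apply: bP; exists phi.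
Qed.

(** Saturation for tuples reduces to saturation for elements: realize the last
    variables by induction in the formulas where the first one is quantified
    existentially, then realize the first variable over that realization. *)
Lemma saturatedn n V (v : V -> C) (p : set (formula L ('I_n + V))) :
  small K V -> directed_type v p ->
  (forall phi, p phi -> exists a, sat phi (sumf a v)) ->
  exists a, forall phi, p phi -> sat phi (sumf a v).
Proof.
move=> sV; elim: n p => [|n IH] p [[phi0 p0] pdir] psat.
  have [a aP] := psat _ p0; exists a => phi /psat[b]; congr (sat _ (sumf _ _)).
  by apply/funext => -[].
pose h (x : 'I_n.+1 + V) : option ('I_n + V) := match x with
  | inl i => omap inl (unlift ord0 i) | inr w => Some (inr w) end.
pose cons b (a : 'I_n -> C) i := oapp a b (unlift ord0 i).
have hE a b : oapp (sumf a v) b \o h = sumf (cons b a) v.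
  by apply/funext => -[i|w] //=; rewrite /cons; case: unliftP.
have consE a : cons (a ord0) (a \o lift ord0) = a.
  by apply/funext => i; rewrite /cons; case: unliftP => [k|] ->.
have exE phi a : sat (FEx (fren phi h)) (sumf a v) =
    exists b, sat phi (sumf (cons b a) v).
  by rewrite sat_ex; apply/propext; split=> -[b bP]; exists b; move: bP;
    rewrite sat_fren hE.
have [||a aP] := IH [set FEx (fren phi h) | phi in p].
- split; first by exists (FEx (fren phi0 h)), phi0.
  move=> _ _ [phi pphi <-] [psi ppsi <-].
  have [chi pchi chiP] := pdir _ _ pphi ppsi.
  exists (FEx (fren chi h)); first by exists chi.
  by move=> a; rewrite !exE => -[b /chiP[? ?]]; split; exists b.
- move=> _ [phi /psat[a aP] <-]; exists (a \o lift ord0).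
  by rewrite exE; exists (a ord0); rewrite consE.
have [||||b bP] := @saturated1 _ (sumf a v) [set fren phi h | phi in p].
- exact (small_sum limK (small_ord limK n) sV).
- by exists (fren phi0 h), phi0.
- move=> _ _ [phi pphi <-] [psi ppsi <-].
  have [chi pchi chiP] := pdir _ _ pphi ppsi.
  exists (fren chi h); first by exists chi.
  by move=> b; rewrite !sat_fren hE => /chiP.
- move=> _ [phi pphi <-].
  have := aP (FEx (fren phi h)); rewrite exE => -[|b bP]; first by exists phi.
  by exists b; rewrite sat_fren hE.
exists (cons b a) => phi pphi.
by have := bP (fren phi h); rewrite sat_fren hE; apply; exists phi.
Qed.

End Saturation.

(** Equality of the types of [v] and [w] makes the assignment [v x |-> w x]
    well defined on the range of [v] and elementary there. *)
Lemma homogeneous_family V (v w : V -> C) :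
  strongly_homogeneous K C -> small K V ->
  (forall phi : formula L V, sat phi v <-> sat phi w) ->
  exists2 s : C -> C, automorphism s & forall x, s (v x) = w x.
Proof.
move=> homC sV vw.
pose h x : range v := SigSub (mem_set (imageT v x)).
have hsurj (y : range v) : exists x, h x = y.
  case: y => y yP; have [x _ xy] := set_mem yP; exists x; exact/val_inj.
have [g gK] := choice hsurj.
have sA : range v #< [set: K] by rewrite small_setP; apply: small_surj hsurj sV.
have vg : v \o g = \val by apply/funext => y /=; rewrite -[in RHS](gK y).
have [|s auts sE] := homC _ sA (w \o g).
  by move=> phi; rewrite -vg -!(sat_fren phi g) vw.
exists s => // x.
have -> : v x = \val (h x) by [].
rewrite sE /=.
have /vw : sat (FEq (TVar L (g (h x))) (TVar L x)) v.
  by rewrite /= (_ : v (g (h x)) = (v \o g) (h x)) // vg.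
by [].
Qed.

End Monster.

(** * The group of points in the monster model *)

Section GroupFormulas.
Variables (L : language) (M : structure L) (G : topologicalGroupType).
Variable D : definable_group M G.
Local Notation n := (gdim D).

(** Formulas whose variables, indexed by [V], range over the group; their
    semantics over a group computes to a readable statement, and [gtr] turns
    them into formulas of the language, with parameters in [M]. *)
Inductive gform (V : Type) : Type :=
| GAt of formula L (V * 'I_n + M)
| GMul of V & V & V
| GPred (U : set G) of open U & V
| GNot of gform V
| GImp of gform V & gform V
| GAnd of gform V & gform V
| GAll of gform (option V)
| GEx of gform (option V).

Fixpoint gtr (V : Type) (phi : gform V) : formula L (V * 'I_n + M) :=
  let h (x : option V * 'I_n + M) : (V * 'I_n + M) + 'I_n := match x with
    | inl (Some y, i) => inl (inl (y, i))
    | inl (None, i) => inr i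
    | inr m => inl (inr m)
    end in
  match phi with
  | GAt phi => phi
  | GMul x y z =>
      fren (gmul D) (fun i => inl (val3 (pair x) (pair y) (pair z) i))
  | GPred U _ x => FRel (gpred D U) (fun i => TVar L (inl (x, i)))
  | GNot phi => FNot (gtr phi)
  | GImp phi psi => FImp (gtr phi) (gtr psi)
  | GAnd phi psi => FAnd (gtr phi) (gtr psi)
  | GAll phi => FAllI (FImp (fren (gdom D) inr) (fren (gtr phi) h))
  | GEx phi =>
      FNot (FAllI (FImp (fren (gdom D) inr) (FNot (fren (gtr phi) h))))
  end.

Section Semantics.
Variables (N : structure L) (k : M -> N) (T : Type) (emb : T -> 'I_n -> N).

Definition genv V (e : V -> T) : V * 'I_n + M -> N :=
  sumf (fun p => emb (e p.1) p.2) k.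

Variables (mulr : T -> T -> T -> Prop) (P : set G -> T -> Prop).

Fixpoint gsat (V : Type) (phi : gform V) : (V -> T) -> Prop :=
  match phi with
  | GAt phi => fun e => sat phi (genv e)
  | GMul x y z => fun e => mulr (e x) (e y) (e z)
  | GPred U _ x => fun e => P U (e x)
  | GNot phi => fun e => ~ gsat phi e
  | GImp phi psi => fun e => gsat phi e -> gsat psi e
  | GAnd phi psi => fun e => gsat phi e /\ gsat psi e
  | GAll phi => fun e => forall a, gsat phi (oapp e a)
  | GEx phi => fun e => exists a, gsat phi (oapp e a)
  end.

Hypothesis domE : forall a, sat (gdom D) a <-> exists x, a = emb x.
Hypothesis mulE : forall x y z,
  sat (gmul D) (val3 (emb x) (emb y) (emb z)) <-> mulr x y z.
Hypothesis predE : forall U x, open U -> irel (gpred D U) (emb x) <-> P U x.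

Lemma sat_gtr V (phi : gform V) (e : V -> T) :
  sat (gtr phi) (genv e) = gsat phi e.
Proof.
have hE V' (e' : V' -> T) x :
    sumf (genv e') (emb x) \o (fun x : option V' * 'I_n + M => match x with
      | inl (Some y, i) => inl (inl (y, i))
      | inl (None, i) => inr i
      | inr m => inl (inr m)
      end) = genv (oapp e' x).
  by apply/funext => -[[[y|] i]|m].
elim: phi e => {V} // [V x y z|V U oU x|V phi IH|V phi IH1 psi IH2|
    V phi IH1 psi IH2|V phi IH|V phi IH] e /=.
- rewrite sat_fren; apply/propext; rewrite -mulE.
  rewrite (_ : _ \o _ = val3 (emb (e x)) (emb (e y)) (emb (e z))) //.
  by apply/funext => -[[|]|].
- by apply/propext; rewrite -predE.
- by rewrite IH.
- by rewrite IH1 IH2.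
- by rewrite [LHS](sat_and (gtr phi) (gtr psi)) IH1 IH2.
- rewrite sat_alli; apply/propext; split=> [H x|H a].
    have := H (emb x); rewrite /= !sat_fren hE IH; apply.
    by apply/domE; exists x.
  by rewrite /= !sat_fren => /(iffLR (domE a))[x ->]; rewrite hE IH.
- rewrite sat_alli; apply/propext; split.
    move=> H; apply: contrapT => nH; apply: H => a /=.
    rewrite !sat_fren => /(iffLR (domE a))[x ->]; rewrite hE IH => Hx.
    by apply: nH; exists x.
  move=> [x Hx] /(_ (emb x)) /=; rewrite !sat_fren hE IH; apply => //.
  by apply/domE; exists x.
Qed.

End Semantics.

(** The statement that a formula makes about the group [G] itself. *)
Definition gsatM V (phi : gform V) (e : V -> G) : Prop :=
  gsat id (gemb D) (fun x y z => (x * y)%g = z) id phi e.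

Lemma sat_gtrM V (phi : gform V) (e : V -> G) :
  sat (gtr phi) (genv id (gemb D) e) = gsatM phi e.
Proof.
apply: sat_gtr => [a|x y z|U x oU].
- by rewrite gdomP.
- rewrite gmulP; split=> [[g [h []]]|<-]; last by exists x, y.
  by move=> /gemb_inj-> /gemb_inj-> /gemb_inj->.
- rewrite gpredP //; split=> [[g Ug /gemb_inj->]//|Ux]; by exists x.
Qed.

End GroupFormulas.

Arguments GMul {L M G D V}.
Arguments GPred {L M G D V U}.
Arguments GAt {L M G D V}.

Section Points.
Variables (L : language) (M : structure L) (G : topologicalGroupType).
Variable D : definable_group M G.
Variables (C : structure L) (j : M -> C).
Hypothesis elj : elementary_embedding j.
Local Notation n := (gdim D).

Lemma Gstar_emb g : @Gstar L M G D C (j \o gemb D g).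
Proof. by apply/elj/gdomP; exists g. Qed.

Lemma star_Gstar U a : open U -> @star L M G D C U a -> @Gstar L M G D C a.
Proof.
move=> oU; apply: (@transfer_valid _ _ _ _ _
  (FImp (FRel (gpred D U) (fun i => TVar L i)) (gdom D)) elj) => v /=.
by move=> /(iffLR (gpredP oU v))[g _ ->]; apply/gdomP; exists g.
Qed.

Lemma star_mul_Gstar (a b c : 'I_n -> C) : @star_mul L M G D C a b c ->
  [/\ @Gstar L M G D C a, @Gstar L M G D C b & @Gstar L M G D C c].
Proof.
pose psi f := FImp (gmul D) (fren (gdom D) f).
have H f : (forall v : 'I_n + 'I_n + 'I_n -> M, sat (psi f) v) ->
    sat (psi f) (val3 a b c).
  by move=> Hf; exact: (@transfer_valid _ _ _ _ _ (psi f) elj).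
have V v : sat (gmul D) v ->
      exists g h, v = val3 (gemb D g) (gemb D h) (gemb D (g * h)%g).
  have -> : v = val3 (v \o (inl \o inl)) (v \o (inl \o inr)) (v \o inr).
    by apply/funext => -[[|]|].
  by move=> /gmulP[g [h [-> -> ->]]]; exists g, h.
move=> abc; split.
- have := H (inl \o inl); rewrite /= sat_fren; apply => // v.
  by move=> /V[g [h ->]]; rewrite sat_fren; apply/gdomP; exists g.
- have := H (inl \o inr); rewrite /= sat_fren; apply => // v.
  by move=> /V[g [h ->]]; rewrite sat_fren; apply/gdomP; exists h.
- have := H inr; rewrite /= sat_fren; apply => // v.
  by move=> /V[g [h ->]]; rewrite sat_fren; apply/gdomP; exists (g * h)%g.
Qed.

(** The points of the group in the monster model; the elementarity proof is a
    parameter because the group axioms are transferred along it. *)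
Definition gpoint of elementary_embedding j := {a : 'I_n -> C | @Gstar L M G D C a}.
Local Notation gst := (gpoint elj).

HB.instance Definition _ := gen_eqMixin gst.
HB.instance Definition _ := gen_choiceMixin gst.

Definition gcoord (x : gst) : 'I_n -> C := sval x.

Lemma gcoord_inj : injective gcoord.
Proof. by move=> [a Ga] [b Gb] /= E; apply: eq_exist. Qed.

Definition gincl (g : G) : gst := exist _ _ (Gstar_emb g).

Definition starG U : set gst := [set x | @star L M G D C U (gcoord x)].

Let mulr x y z := @star_mul L M G D C (gcoord x) (gcoord y) (gcoord z).

(** As long as the group laws of the points are not available, their product
    can only be spoken of as a relation. *)
Lemma transfer_relational V (phi : gform D V) (e : V -> G) :
  gsatM phi e <-> gsat j gcoord mulr starG phi (gincl \o e).
Proof.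
rewrite -(@sat_gtr _ _ _ _ _ _ _ gcoord) //; last first.
  move=> a; split=> [Ga|[[x Gx] ->]//]; by exists (exist _ _ Ga).
rewrite -sat_gtrM -elj.
by rewrite (_ : j \o _ = genv j gcoord (gincl \o e)) //; apply/funext => -[].
Qed.

Let valid (phi : gform D void) :
  (forall e, gsatM phi e) -> forall e, gsat j gcoord mulr starG phi e.
Proof.
move=> H e; have e0 : void -> G by case.
by move: (H e0); rewrite transfer_relational; congr gsat; apply/funext => -[].
Qed.

Let v0 : void -> gst. Proof. by case. Qed.

Let star_mul_total (x y : gst) : exists z, mulr x y z.
Proof.
apply: (valid (phi := GAll (GAll (GEx
  (GMul (Some (Some None)) (Some None) None)))) _ v0).
by move=> e g h; exists (g * h)%g.
Qed.

Let star_mul_fun (x y z z' : gst) : mulr x y z -> mulr x y z' -> z = z'.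
Proof.
move=> zP z'P; apply/gcoord_inj/funext => i.
pose t (u : option (option (option (option void)))) :=
  TVar L (inl (u, i) : _ * 'I_n + M).
apply: (valid (phi := GAll (GAll (GAll (GAll
  (GImp (GMul (Some (Some (Some None))) (Some (Some None)) (Some None))
  (GImp (GMul (Some (Some (Some None))) (Some (Some None)) None)
    (GAt (FEq (t (Some None)) (t None))))))))) _ v0) zP z'P.
by move=> e x' y' z1 z2 /= -> ->.
Qed.

Definition pmul x y := sval (cid (star_mul_total x y)).

Let pmulP x y z : mulr x y z <-> pmul x y = z.
Proof.
have H := svalP (cid (star_mul_total x y)).
by split=> [/(star_mul_fun H)|<-].
Qed.

Let mulrE : mulr = fun x y z => pmul x y = z.
Proof. by do 3 apply/funext => ?; apply/propext/pmulP. Qed.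

Let gsatP V (phi : gform D V) (e : V -> gst) :
  gsat j gcoord mulr starG phi e =
  gsat j gcoord (fun x y z => pmul x y = z) starG phi e.
Proof. by rewrite mulrE. Qed.

Let pmulA : associative pmul.
Proof.
move=> x y z.
(* From [b * c = u], [a * u = v] and [a * b = w] follows [w * c = v]. *)
pose phi : gform D void := GAll (GAll (GAll (GAll (GAll (GAll
  (GImp (GMul (Some (Some (Some (Some None)))) (Some (Some (Some None)))
    (Some (Some None)))
  (GImp (GMul (Some (Some (Some (Some (Some None))))) (Some (Some None))
    (Some None))
  (GImp (GMul (Some (Some (Some (Some (Some None)))))
    (Some (Some (Some (Some None)))) None)
  (GMul None (Some (Some (Some None))) (Some None)))))))))).
have H e : gsatM phi e by move=> a b c u v w /= <- <- <-; rewrite mulgA.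
by have := valid H v0; rewrite gsatP /phi /= => /(_ _ _ _ _ _ _ erefl erefl erefl) ->.
Qed.

Let pmul1 : left_id (gincl 1%g) pmul.
Proof.
move=> x.
have := transfer_relational (GAll (GMul (Some tt) None None)) (fun=> 1%g).
by rewrite gsatP /= => -[H _]; apply: H => a; rewrite /= mul1g.
Qed.

Let pmulr1 : right_id (gincl 1%g) pmul.
Proof.
move=> x.
have := transfer_relational (GAll (GMul None (Some tt) None)) (fun=> 1%g).
by rewrite gsatP /= => -[H _]; apply: H => a; rewrite /= mulg1.
Qed.

Let pinvP x : exists y, pmul y x = gincl 1%g /\ pmul x y = gincl 1%g.
Proof.
have := transfer_relational (GAll (GEx
  (GAnd (GMul None (Some None) (Some (Some tt)))
        (GMul (Some None) None (Some (Some tt)))))) (fun=> 1%g).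
rewrite gsatP /= => -[H _]; apply: H => a; exists (a^-1)%g.
by rewrite /= mulgV mulVg.
Qed.

Definition pinv x := sval (cid (pinvP x)).

Let pmulVx : left_inverse (gincl 1%g) pinv pmul.
Proof. by move=> x; case: (svalP (cid (pinvP x))). Qed.

Let pmulxV : right_inverse (gincl 1%g) pinv pmul.
Proof. by move=> x; case: (svalP (cid (pinvP x))). Qed.

HB.instance Definition _ :=
  isGroup.Build gst pmulA pmul1 pmulr1 pmulVx pmulxV.

Lemma star_mulP x y z :
  @star_mul L M G D C (gcoord x) (gcoord y) (gcoord z) <-> (x * y)%g = z :> gst.
Proof. exact: pmulP. Qed.

Definition gsatC V (phi : gform D V) (e : V -> gst) : Prop :=
  gsat j gcoord (fun x y z => (x * y)%g = z) starG phi e.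

Lemma transfer V (phi : gform D V) (e : V -> G) :
  gsatM phi e <-> gsatC phi (gincl \o e).
Proof. by rewrite transfer_relational gsatP. Qed.

Lemma sat_gtrC V (phi : gform D V) (e : V -> gst) :
  sat (gtr phi) (genv j gcoord e) = gsatC phi e.
Proof.
apply: sat_gtr => [a|x y z|U x oU]; [|exact: star_mulP|by []].
by split=> [Ga|[[x Gx] ->]//]; exists (exist _ _ Ga).
Qed.

Lemma ginclM g h : gincl (g * h)%g = (gincl g * gincl h)%g.
Proof.
by apply/esym/(iffLR (transfer (GMul g h (g * h)%g) id)).
Qed.

End Points.

(** * Stars of open sets *)

Section Stars.
Variables (L : language) (M : structure L) (G : topologicalGroupType).
Variable D : definable_group M G.
Variables (C : structure L) (j : M -> C).
Hypothesis elj : elementary_embedding j.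
Local Notation gst := (gpoint D elj).
Local Notation incl := (gincl D elj).
Local Notation st := (@starG L M G D C j elj).

Local Notation transfer := (@transfer L M G D C j elj).

Implicit Types (U V W : set G) (x y z : gst) (g : G).

Lemma inclV g : incl (g^-1)%g = (incl g)^-1%g.
Proof. by apply/esym/mulg1_eq; rewrite -ginclM mulgV. Qed.

Lemma st_incl U g : open U -> st U (incl g) <-> U g.
Proof. by move=> oU; exact: iff_sym (transfer (GPred oU g) id). Qed.

Lemma st_sub U V : open U -> open V -> U `<=` V -> st U `<=` st V.
Proof.
move=> oU oV UV x.
by apply: (iffLR (transfer
  (GAll (GImp (GPred oU None) (GPred oV None))) id)) => y /=; apply: UV.
Qed.

Lemma st_setT x : st setT x.
Proof. by apply: (iffLR (transfer (GAll (GPred openT None)) id)). Qed.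

Lemma st_setU U V x : open U -> open V -> st (U `|` V) x -> st U x \/ st V x.
Proof.
move=> oU oV; have oUV := openU oU oV.
have := iffLR (transfer (GAll (GImp (GPred oUV None)
  (GImp (GNot (GPred oU None)) (GPred oV None)))) id) _ x.
move=> /= /(_ _)/[apply] H; have [|nUx] := pselect (st U x); first by left.
by right; apply: H => // y [].
Qed.

Lemma st_disjoint U V x : open U -> open V -> U `&` V `<=` set0 ->
  st U x -> ~ st V x.
Proof.
move=> oU oV UV; apply: (iffLR (transfer
  (GAll (GImp (GPred oU None) (GNot (GPred oV None)))) id)) => y /= Uy Vy.
exact: (UV y).
Qed.

Lemma st_mul U V W x y : open U -> open V -> open W ->
  (forall g h, U g -> V h -> W (g * h)%g) -> st U x -> st V y -> st W (x * y)%g.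
Proof.
move=> oU oV oW UVW Ux Vy.
have /= H := iffLR (transfer (GAll (GAll (GAll
  (GImp (GPred oU (Some (Some None))) (GImp (GPred oV (Some None))
  (GImp (GMul (Some (Some None)) (Some None) None) (GPred oW None))))))) id).
by apply: (H _ x y _ Ux Vy erefl) => g h _ Ug Vh <-; apply: UVW.
Qed.

Lemma st_mulP U V W z : open U -> open V -> open W ->
  (forall g, W g -> exists g1 g2, [/\ U g1, V g2 & (g1 * g2)%g = g]) ->
  st W z -> exists x y, [/\ st U x, st V y & (x * y)%g = z].
Proof.
move=> oU oV oW WUV Wz.
have /= := iffLR (transfer (GAll (GImp (GPred oW None) (GEx (GEx
  (GAnd (GPred oU (Some None)) (GAnd (GPred oV None)
    (GMul (Some None) None (Some (Some None))))))))) id) _ z Wz.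
case=> [g /WUV[g1 [g2 [? ? ?]]]|x [y [? [? ?]]]]; first by exists g1, g2.
by exists x, y.
Qed.

Lemma st_inv U V x : open U -> open V -> (forall g, U g -> V (g^-1)%g) ->
  st U x -> st V (x^-1)%g.
Proof.
move=> oU oV UV Ux.
have /= := iffLR (transfer (GAll (GImp (GPred oU None) (GEx
  (GAnd (GMul (Some None) None (Some (Some 1%g))) (GPred oV None))))) id) _ x Ux.
case=> [g Ug|y [/mulg1_eq-> //]].
by exists (g^-1)%g; rewrite mulgV; split=> //; apply: UV.
Qed.

Lemma st_lmul U V g x : open U -> open V -> (forall h, U h -> V (g * h)%g) ->
  st U x -> st V (incl g * x)%g.
Proof.
move=> oU oV UV Ux.
have /= := iffLR (transfer (GAll (GImp (GPred oU None) (GEx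
  (GAnd (GMul (Some (Some g)) (Some None) None) (GPred oV None))))) id) _ x Ux.
by case=> [h Uh|y [<-]//]; exists (g * h)%g; split=> //; apply: UV.
Qed.

Lemma st_rmul U V g x : open U -> open V -> (forall h, U h -> V (h * g)%g) ->
  st U x -> st V (x * incl g)%g.
Proof.
move=> oU oV UV Ux.
have /= := iffLR (transfer (GAll (GImp (GPred oU None) (GEx
  (GAnd (GMul (Some None) (Some (Some g)) None) (GPred oV None))))) id) _ x Ux.
by case=> [h Uh|y [<-]//]; exists (h * g)%g; split=> //; apply: UV.
Qed.

End Stars.

(** * Types of points *)

Section Types.
Variables (L : language) (M : structure L) (G : topologicalGroupType).
Variable D : definable_group M G.
Variables (K : Type) (C : structure L) (j : M -> C).
Hypothesis elj : elementary_embedding j.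
Hypothesis limK : uncountable_strong_limit K.
Hypothesis smallM : small K M.
Hypothesis satC : saturated K C.
Hypothesis homC : strongly_homogeneous K C.
Local Notation n := (gdim D).
Local Notation gst := (gpoint D elj).
Local Notation coord := (@gcoord L M G D C j elj).
Local Notation env := (genv j coord).

Let small_var V : small K V -> small K (V * 'I_n + M).
Proof.
move=> sV; exact (small_sum limK (small_prod limK sV (small_ord limK n)) smallM).
Qed.

(** Saturation for one unknown point of the group, with the points [e] and the
    elements of [M] as parameters. *)
Lemma compactness B (e : B -> gst) (p : set (formula L (option B * 'I_n + M))) :
  small K B -> p !=set0 ->
  (forall phi psi, p phi -> p psi -> exists2 chi, p chi & forall x,
    sat chi (env (oapp e x)) ->
    sat phi (env (oapp e x)) /\ sat psi (env (oapp e x))) ->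
  (forall phi, p phi -> exists x, sat phi (env (oapp e x))) ->
  exists x, forall phi, p phi -> sat phi (env (oapp e x)).
Proof.
move=> sB [phi0 p0] pdir psat.
pose h (u : option B * 'I_n + M) : 'I_n + (B * 'I_n + M) := match u with
  | inl (None, i) => inl i
  | inl (Some b, i) => inr (inl (b, i))
  | inr m => inr (inr m) end.
pose q phi := FAnd (fren (gdom D) inl) (fren phi h).
have hE x : sumf (coord x) (env e) \o h = env (oapp e x).
  by apply/funext => -[[[b|] i]|m].
have qE a phi : sat (q phi) (sumf a (env e)) <->
    exists2 x, a = coord x & sat phi (env (oapp e x)).
  rewrite sat_and !sat_fren; split=> [[Ga]|[x ->]].
    pose x : gst := exist _ a Ga.
    by rewrite -[a]/(coord x) hE; exists x.
  by rewrite hE; split=> //; exact: (svalP x).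
have [|||a aP] := @saturatedn K L C limK satC n _ (env e) [set q phi | phi in p].
- exact: small_var.
- split; first by exists (q phi0), phi0.
  move=> _ _ [phi pphi <-] [psi ppsi <-].
  have [chi pchi chiP] := pdir _ _ pphi ppsi; exists (q chi); first by exists chi.
  by move=> a /qE[x ax /chiP[? ?]]; split; apply/qE; exists x.
- by move=> _ [phi /psat[x xP] <-]; exists (coord x); apply/qE; exists x.
have /qE[x ax _] := aP _ (ex_intro2 _ _ _ p0 erefl).
exists x => phi pphi.
by have /qE[y] := aP _ (ex_intro2 _ _ _ pphi erefl); rewrite ax => /gcoord_inj <-.
Qed.

(** The formulas have parameters in [M]: this is equality of types over [M]. *)
Definition same_type V (e e' : V -> gst) :=
  forall phi : formula L (V * 'I_n + M), sat phi (env e) <-> sat phi (env e').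

Lemma sat_automorphism (s : C -> C) V (phi : formula L V) (v : V -> C) :
  automorphism s -> sat phi (s \o v) <-> sat phi v.
Proof.
move=> [[t sK tK] sfun srel].
have evalE W (u : term L W) (w : W -> C) : Defs.eval (s \o w) u = s (Defs.eval w u).
  elim: u => //= k f ts IH; rewrite sfun; congr ifunc; apply/funext => i; exact: IH.
elim: phi v => {V} [V u u'|V k r ts|V|V phi IH1 psi IH2|V phi IH] v //=.
- by rewrite !evalE; split=> [|->//]; apply: (can_inj sK).
- rewrite (_ : (fun i => _) = s \o (fun i => Defs.eval v (ts i))); first exact: srel.
  by apply/funext => i; rewrite evalE.
- by rewrite IH1 IH2.
- have oappE a : oapp (s \o v) (s a) = s \o oapp v a by apply/funext; case.
  split=> H a; first by apply/IH; rewrite -oappE.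
  by rewrite -(tK a) oappE IH.
Qed.

Lemma same_type_automorphism V (e e' : V -> gst) : small K V -> same_type e e' ->
  exists2 s : C -> C, automorphism s /\ (forall m, s (j m) = j m) &
    forall v, s \o coord (e v) = coord (e' v).
Proof.
move=> sV ee.
have [s auts sE] := homogeneous_family homC (small_var sV) ee.
exists s; first by split=> // m; have := sE (inr m).
by move=> v; apply/funext => i; have := sE (inl (v, i)).
Qed.

Definition pairf T (x y : T) (b : bool) : T := if b then y else x.

Lemma small_bool : small K bool.
Proof. by apply: (@small_inj _ _ _ nat_of_bool) (small_nat limK) => -[] []. Qed.

Lemma same_type_quotient (H : set ('I_n -> C)) (x y x' y' : gst) :
  invariant_over_model j H -> same_type (pairf x y) (pairf x' y') ->
  H (coord (x^-1 * y)%g) <-> H (coord (x'^-1 * y')%g).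
Proof.
move=> Hinv /(same_type_automorphism small_bool)[s [auts sj] sE].
rewrite -(Hinv s auts sj).
suff -> : s \o coord (x^-1 * y)%g = coord (x'^-1 * y')%g by [].
have /star_mulP sm : (x * (x^-1 * y))%g = y by rewrite mulVKg.
have {}sm : star_mul (coord x') (s \o coord (x^-1 * y)%g) (coord y').
  rewrite -(sE false) -(sE true) /=.
  move: sm; rewrite /star_mul -(sat_automorphism _ _ auts).
  by congr sat; apply/funext => -[[|]|].
have [_ Gz _] := star_mul_Gstar elj sm.
pose z : gst := exist _ _ Gz.
have /star_mulP E : star_mul (coord x') (coord z) (coord y') by [].
by rewrite -E mulKg.
Qed.

End Types.

(** * Coheirs and cosets of invariant subgroups *)

Section Coheirs.
Variables (L : language) (M : structure L) (G : topologicalGroupType).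
Variable D : definable_group M G.
Variables (K : Type) (C : structure L) (j : M -> C).
Hypothesis elj : elementary_embedding j.
Hypothesis limK : uncountable_strong_limit K.
Hypothesis smallM : small K M.
Hypothesis satC : saturated K C.
Local Notation n := (gdim D).
Local Notation gst := (gpoint D elj).
Local Notation incl := (gincl D elj).
Local Notation coord := (@gcoord L M G D C j elj).
Local Notation env := (genv j coord).

Section OneUltrafilter.
Variable W : set_system G.
Hypothesis ultraW : UltraFilter W.

(** The ultrafilter [W] defines a global type that is finitely satisfiable in
    [G], hence invariant over [M]; a coheir realizes its restriction to the
    parameters [e] and [M]. *)
Definition coheir B (e : B -> gst) (c : gst) :=
  forall phi : formula L (option B * 'I_n + M),
    sat phi (env (oapp e c)) <-> W [set g | sat phi (env (oapp e (incl g)))].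

Definition realizes (c : gst) :=
  forall phi : formula L (unit * 'I_n + M),
    sat phi (env (fun=> c)) <-> W [set g | sat phi (env (fun=> incl g))].

Lemma coheir_exists B (e : B -> gst) : small K B -> exists c, coheir e c.
Proof.
move=> sB.
pose p := [set phi : formula L (option B * 'I_n + M) |
  W [set g | sat phi (env (oapp e (incl g)))]].
have [|||c cP] := @compactness _ _ _ _ _ _ _ elj limK smallM satC B e p sB.
- by exists (FNot (FFalse L _)); apply: filterS filterT => g _ [].
- move=> phi psi pphi ppsi; exists (FAnd phi psi); last by move=> x; rewrite sat_and.
  by apply: filterS (filterI pphi ppsi) => g [? ?]; rewrite /mkset sat_and.
- by move=> phi /filter_ex[g gP]; exists (incl g).
exists c => phi; split=> [cphi|]; last exact: cP.
have [//|nW] := in_ultra_setVsetC [set g | sat phi (env (oapp e (incl g)))] ultraW.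
by have := cP (FNot phi) nW cphi.
Qed.

Lemma coheir_rename B B' (f : B' -> B) (e : B -> gst) c :
  coheir e c -> coheir (e \o f) c.
Proof.
move=> cP phi.
pose h (u : option B' * 'I_n + M) : option B * 'I_n + M :=
  match u with inl (v, i) => inl (omap f v, i) | inr m => inr m end.
have hE (d : gst) : env (oapp (e \o f) d) = env (oapp e d) \o h.
  by apply/funext => -[[[]]|].
rewrite hE -(sat_fren phi h) cP.
by under eq_set do rewrite sat_fren -hE.
Qed.

Lemma coheir_realizes B (e : B -> gst) c : coheir e c -> realizes c.
Proof.
move=> cP phi.
pose h (u : unit * 'I_n + M) : option B * 'I_n + M :=
  match u with inl (_, i) => inl (None, i) | inr m => inr m end.
have hE (d : gst) : env (fun=> d) = env (oapp e d) \o h.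
  by apply/funext => -[[[]]|].
rewrite hE -(sat_fren phi h) cP.
by under eq_set do rewrite sat_fren -hE.
Qed.

Lemma realizes_same_type c c' : realizes c -> realizes c' ->
  same_type (fun _ : unit => c) (fun=> c').
Proof. by move=> cP c'P phi; rewrite cP c'P. Qed.

(** Which formulas hold of a coheir over [x] is decided by their truth at [x]
    and the elements of [G], hence by the type of [x] over [M]. *)
Lemma coheir_pair_type x c x' c' :
  same_type (fun _ : unit => x) (fun=> x') ->
  coheir (fun _ : unit => x) c -> coheir (fun _ : unit => x') c' ->
  same_type (pairf x c) (pairf x' c').
Proof.
move=> xx cP c'P phi.
pose h (u : bool * 'I_n + M) : option unit * 'I_n + M := match u with
  | inl (b, i) => inl (if b then None else Some tt, i) | inr m => inr m end.
have hE (y d : gst) : env (pairf y d) = env (oapp (fun _ : unit => y) d) \o h.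
  by apply/funext => -[[[]]|].
rewrite !hE -!(sat_fren phi h) cP c'P.
suff -> : [set g | sat (fren phi h) (env (oapp (fun _ : unit => x) (incl g)))] =
    [set g | sat (fren phi h) (env (oapp (fun _ : unit => x') (incl g)))] by [].
apply/funext => g; apply/propext => /=.
pose f (u : option unit * 'I_n + M) : unit * 'I_n + M := match u with
  | inl (Some _, i) => inl (tt, i) | inl (None, i) => inr (gemb D g i)
  | inr m => inr m end.
have fE y : env (oapp (fun _ : unit => y) (incl g)) = env (fun _ : unit => y) \o f.
  by apply/funext => -[[[[]|] i]|].
by rewrite !fE -!(sat_fren _ f).
Qed.

End OneUltrafilter.

(** By elementarity, a formula true of [a] is true of some element of [G]. *)
Lemma realizes_exists a : exists2 W : set_system G, UltraFilter W & realizes W a.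
Proof.
pose S (phi : formula L (unit * 'I_n + M)) :=
  [set g | sat phi (env (fun=> incl g))].
pose F : set_system G :=
  [set A | exists2 phi, sat phi (env (fun=> a)) & S phi `<=` A].
have FF : ProperFilter F.
  split=> [[phi phia phi0]|].
    pose h (u : unit * 'I_n + M) : option void * 'I_n + M :=
      match u with inl (_, i) => inl (None, i) | inr m => inr m end.
    have v0 : void -> G by case.
    have hE (d : gst) : env (oapp (incl \o v0) d) \o h = env (fun=> d).
      by apply/funext => -[[]|].
    have := iffRL (transfer elj (GEx (GAt (fren phi h))) v0).
    case=> [|g]; first by exists a; rewrite /= sat_fren hE.
    rewrite /= sat_fren -elj => gphi; apply: (phi0 g); rewrite /S /= -hE.
    by move: gphi; congr sat; apply/funext => -[[]|].
  split=> [|A B [phi phia phiA] [psi psia psiB]|A B AB [phi phia phiA]].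
  - by exists (FNot (FFalse L _)) => // -[].
  - exists (FAnd phi psi); first by rewrite sat_and.
    by move=> g; rewrite /S /mkset sat_and => -[/phiA ? /psiB].
  - by exists phi => //; apply: subset_trans AB.
have [W [ultraW FW]] := ultraFilterLemma FF.
exists W => // phi; split=> [aphi|Wphi]; first by apply: FW; exists phi.
apply: contrapT => naphi.
have /FW nW : F (S (FNot phi)) by exists (FNot phi).
by have [g [gphi]] := filter_ex (filterI Wphi nW); apply.
Qed.

Definition gsubgroup (P : set gst) :=
  P 1%g /\ forall x y, P x -> P y -> P (x^-1 * y)%g.

(** Invariance over [M] is used for cosets only; it is phrased with types, since
    coheirs are compared through their types. *)
Definition type_invariant (P : set gst) := forall x y x' y' : gst,
  same_type (pairf x y) (pairf x' y') -> P (x^-1 * y)%g -> P (x'^-1 * y')%g.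

(** Representatives of the cosets are indexed by a small type, so that they can
    serve as parameters. *)
Definition small_index (P : set gst) := exists (B : Type) (e : B -> gst),
  small K B /\ forall x, exists b, P ((e b)^-1 * x)%g.

Section InvariantSubgroup.
Variable P : set gst.
Hypothesis groupP : gsubgroup P.
Hypothesis invP : type_invariant P.
Hypothesis indexP : small_index P.

Let P_inv x : P x -> P (x^-1)%g.
Proof. by move=> Px; have := groupP.2 _ _ Px groupP.1; rewrite mulg1. Qed.

Let P_mul x y : P x -> P y -> P (x * y)%g.
Proof. by move=> /P_inv Px /(groupP.2 _ _ Px); rewrite invgK. Qed.

(** A coheir [c0] over a system of representatives of all the cosets is in the
    coset of some representative, hence by invariance so is a coheir [c1] over
    the representatives and [c0]. Thus [c0] and [c1] are in the same coset,
    and the pair of [a] and [c] has the type of the pair of [c0] and [c1]. *)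
Lemma coheir_coset W a c : UltraFilter W -> realizes W a ->
  coheir W (fun _ : unit => a) c -> P (a^-1 * c)%g.
Proof.
move=> ultraW aW cW.
have [B [e [sB eP]]] := indexP.
have [c0 c0W] := coheir_exists ultraW e sB.
have [c1 c1W] := coheir_exists ultraW (oapp e c0) (small_option limK sB).
have [b bc0] := eP c0.
have bc1 : P ((e b)^-1 * c1)%g.
  apply: invP bc0; apply: (coheir_pair_type (W := W)) => //.
    exact: (coheir_rename (fun=> b) c0W).
  exact: (coheir_rename (fun=> Some b) c1W).
have : P (c0^-1 * c1)%g.
  by have := groupP.2 _ _ bc0 bc1; rewrite invgM invgK -mulgA mulVKg.
apply: invP; apply: (coheir_pair_type (W := W)) cW.
  exact/realizes_same_type/aW/coheir_realizes/c0W.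
exact: (coheir_rename (fun=> None) c1W).
Qed.

(** A coheir over both points is in the coset of each of them. *)
Lemma same_type_coset a a' :
  same_type (fun _ : unit => a) (fun=> a') -> P (a^-1 * a')%g.
Proof.
move=> aa'; have [W ultraW aW] := realizes_exists a.
have a'W : realizes W a' by move=> phi; rewrite -aa'.
have [c cW] := coheir_exists ultraW (pairf a a') (small_bool limK).
have ac := coheir_coset ultraW aW (coheir_rename (fun=> false) cW).
have a'c := coheir_coset ultraW a'W (coheir_rename (fun=> true) cW).
by have := P_mul ac (P_inv a'c); rewrite invgM invgK mulgA mulgK.
Qed.

End InvariantSubgroup.

End Coheirs.

(** * Left uniformly open sets and the invariant mean *)

Section LeftUniform.
Variable G : topologicalGroupType.
Implicit Types (X Y : set G) (g u x : G).

(** The stabilizer of such a set under left multiplication is an open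
    subgroup; in other words, the indicator function of the set is uniformly
    continuous for the right uniformity of [G]. *)
Definition lunif X := nbhs (1 : G)%g [set u | forall x, X (u * x)%g <-> X x].

Definition ltrans g X : set G := [set x | X (g * x)%g].

Definition mulset X Y : set G := [set (x * y)%g | x in X & y in Y].

Lemma continuous_mulr g : continuous (fun x : G => (x * g)%g).
Proof.
move=> x; apply: (@continuous_comp _ _ _ (fun x => (x, g)) (fun p => (p.1 * p.2)%g)).
  by apply: cvg_pair; [exact: cvg_id|exact: cvg_cst].
exact: mulg_continuous.
Qed.

Lemma continuous_mull g : continuous (fun x : G => (g * x)%g).
Proof.
move=> x; apply: (@continuous_comp _ _ _ (fun x => (g, x)) (fun p => (p.1 * p.2)%g)).
  by apply: cvg_pair; [exact: cvg_cst|exact: cvg_id].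
exact: mulg_continuous.
Qed.

Lemma continuous_conj g : continuous (fun x : G => (g * x * g^-1)%g).
Proof.
move=> x; apply: (@continuous_comp _ _ _ (fun x => (g * x)%g) (fun x => (x * g^-1)%g)).
  exact: continuous_mull.
exact: continuous_mulr.
Qed.

Lemma open_preimage (f : G -> G) X : continuous f -> open X -> open (f @^-1` X).
Proof. by move/continuousP; apply. Qed.

Lemma open_inv X : open X -> open [set x : G | X (x^-1)%g].
Proof. exact/open_preimage/invg_continuous. Qed.

Lemma lunif_open X : lunif X -> open X.
Proof.
move=> oX; rewrite openE => x Xx.
have := @continuous_mulr (x^-1)%g x; rewrite /continuous_at mulgV => /(_ _ oX).
rewrite /= nbhs_simpl; apply: (@filterS _ (nbhs x)) => y /(_ x).
by rewrite mulgVK => yx; apply/yx.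
Qed.

Lemma lunifT : lunif setT.
Proof. by apply: (@filterE _ (nbhs (1 : G)%g)) => u. Qed.

Lemma lunifC X : lunif X -> lunif (~` X).
Proof. by rewrite /lunif; apply: filterS => u uX x; split=> nX /uX. Qed.

Lemma lunifI X Y : lunif X -> lunif Y -> lunif (X `&` Y).
Proof.
rewrite /lunif => oX oY; apply: filterS (filterI oX oY) => u [uX uY] x.
by split=> -[/uX ? /uY ?].
Qed.

Lemma lunif0 : lunif set0.
Proof. by rewrite -setCT; apply/lunifC/lunifT. Qed.

Lemma lunifU X Y : lunif X -> lunif Y -> lunif (X `|` Y).
Proof.
move=> /lunifC oX /lunifC oY; rewrite -[_ `|` _]setCK setCU.
exact/lunifC/lunifI.
Qed.

Lemma lunifD X Y : lunif X -> lunif Y -> lunif (X `\` Y).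
Proof. by move=> oX /lunifC; apply: lunifI. Qed.

Lemma lunif_ltrans g X : lunif X -> lunif (ltrans g X).
Proof.
move=> oX.
have := @continuous_conj g 1%g; rewrite /continuous_at mulg1 mulgV => /(_ _ oX).
rewrite /= nbhs_simpl; apply: (@filterS _ (nbhs (1 : G)%g)) => u /= uX x.
by rewrite /ltrans /= -(uX (g * x)%g) !mulgA mulgVK.
Qed.

Lemma lunif_mulset X Y : lunif X -> lunif (mulset X Y).
Proof.
rewrite /lunif; apply: filterS => u uX z; split=> -[x Xx [y Yy xy]].
  exists (u^-1 * x)%g; first by apply/uX; rewrite mulVKg.
  by exists y => //; rewrite -mulgA xy mulKg.
by exists (u * x)%g; [apply/uX|exists y => //; rewrite -mulgA xy].
Qed.

Lemma ltrans1 X : ltrans 1%g X = X.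
Proof. by apply/funext => x; rewrite /ltrans /= mul1g. Qed.

Lemma ltransM g h X : ltrans (g * h)%g X = ltrans h (ltrans g X).
Proof. by apply/funext => x; rewrite /ltrans /= mulgA. Qed.

Lemma ltransK g : cancel (ltrans g) (ltrans (g^-1)%g).
Proof. by move=> X; rewrite -ltransM mulgV ltrans1. Qed.

(** * The Stone space of left uniformly open sets *)

(** Left uniformly open sets form a Boolean algebra invariant under
    translation; these are its ultrafilters. *)
Definition is_stone (p : set (set G)) :=
  [/\ p `<=` lunif, forall X, lunif X -> p (~` X) <-> ~ p X,
      forall X Y, p X -> p Y -> p (X `&` Y)
    & forall X Y, lunif Y -> X `<=` Y -> p X -> p Y].

Definition stone := {p | is_stone p}.

HB.instance Definition _ := gen_eqMixin stone.
HB.instance Definition _ := gen_choiceMixin stone.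

Definition clopen X : set stone := [set p | sval p X].

Implicit Types p q : stone.

Lemma stone_eq p q : (forall X, lunif X -> sval p X -> sval q X) -> p = q.
Proof.
case: p q => p pP [q qP] /= pq; apply/eq_exist/seteqP; split=> X.
  by move=> pX; apply: pq (pX); case: pP => pl _ _ _; apply: pl.
case: pP => pl pC _ _; case: qP => ql qC _ _ qX; have oX := ql _ qX.
apply: contrapT => /(pC _ oX) pCX.
by have /(pq _ (lunifC oX))/(qC _ oX) := pCX.
Qed.

Lemma clopenT : clopen setT = setT.
Proof.
apply/seteqP; split=> // -[p [pl pC pI pS]] _ /=.
rewrite /clopen /=; apply: contrapT => npT; apply: (npT).
by apply: (pS (~` setT)) => //; [exact: lunifT|apply/(pC _ lunifT)].
Qed.

Lemma clopenC X : lunif X -> clopen (~` X) = ~` clopen X.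
Proof.
by move=> oX; apply/funext => -[p [pl pC pI pS]]; apply/propext/pC.
Qed.

Lemma clopenI X Y : lunif X -> lunif Y ->
  clopen (X `&` Y) = clopen X `&` clopen Y.
Proof.
move=> oX oY; apply/seteqP; split=> -[p [pl pC pI pS]] /=;
  last by move=> [? ?]; apply: pI.
by move=> pXY; split; [apply: pS pXY => // ? []|apply: pS pXY => // ? []].
Qed.

Lemma clopenU X Y : lunif X -> lunif Y ->
  clopen (X `|` Y) = clopen X `|` clopen Y.
Proof.
move=> oX oY; rewrite -[X `|` Y]setCK setCU clopenC ?clopenI ?clopenC //;
  do ?[exact: lunifC|by apply: lunifI; apply: lunifC].
by rewrite setCI !setCK.
Qed.

Lemma is_stone_principal g : is_stone [set X | lunif X /\ X g].
Proof.
split=> [X []//|X oX|X Y [? ?] [? ?]|X Y oY XY [oX Xg]].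
- by split=> [[_ nX] [_]//|nX]; split; [exact: lunifC|move=> Xg; apply: nX].
- by split=> //; apply: lunifI.
- by split=> //; apply: XY.
Qed.

HB.instance Definition _ :=
  isPointed.Build stone (exist _ _ (is_stone_principal 1%g)).

Definition stone_open (A : set stone) :=
  forall p, A p -> exists X, [/\ lunif X, sval p X & clopen X `<=` A].

Let stone_openT : stone_open setT.
Proof.
move=> p _; exists setT; split=> //; first exact: lunifT.
by rewrite -[sval p setT]/(clopen setT p) clopenT.
Qed.

Let stone_openI A B : stone_open A -> stone_open B -> stone_open (A `&` B).
Proof.
move=> oA oB p [/oA[X [oX pX XA]] /oB[Y [oY pY YB]]].
exists (X `&` Y); split; first exact: lunifI.
  by rewrite -[sval p _]/(clopen (X `&` Y) p) clopenI.
by rewrite clopenI // => q [/XA ? /YB ?].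
Qed.

Let stone_open_bigU (I : Type) (f : I -> set stone) :
  (forall i, stone_open (f i)) -> stone_open (\bigcup_i f i).
Proof.
move=> of_ p [i _ /of_[X [oX pX XA]]]; exists X; split=> //.
by move=> q /XA; exists i.
Qed.

HB.instance Definition _ :=
  isOpenTopological.Build stone stone_openT stone_openI stone_open_bigU.

Lemma openE_stone : open = stone_open. Proof. by []. Qed.

Lemma open_clopen X : lunif X -> open (clopen X).
Proof. by rewrite openE_stone => oX p pX; exists X; split. Qed.

Lemma nbhs_stone p (A : set stone) :
  nbhs p A <-> exists X, [/\ lunif X, sval p X & clopen X `<=` A].
Proof.
split=> [|[X [oX pX XA]]].
  rewrite nbhsE => -[B []]; rewrite openE_stone => oB Bp BA.
  have [X [oX pX XB]] := oB _ Bp.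
  by exists X; split=> //; apply: subset_trans BA.
by apply: filterS XA _; apply: open_nbhs_nbhs; split=> //; exact: open_clopen.
Qed.

(** An ultrafilter [F] on the space converges to the set of the [X] such that
    [clopen X] belongs to [F]. *)
Lemma stone_compact : compact [set: stone].
Proof.
rewrite compact_ultra => F FU _.
have p_stone : is_stone [set X | lunif X /\ F (clopen X)].
  split=> [X []//|X oX|X Y [oX FX] [oY FY]|X Y oY XY [oX FX]].
  - rewrite /mkset clopenC //; split=> [[_ FC] [_ FX]|nFX].
      by have [q []] := filter_ex (filterI FX FC).
    split; first exact: lunifC.
    by have [FX|//] := in_ultra_setVsetC (clopen X) FU; case: nFX.
  - by split; [exact: lunifI|rewrite clopenI //; apply: filterI].
  - split=> //; apply: filterS FX => -[q [ql qC qI qS]] /=; exact: qS.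
exists (exist _ _ p_stone); split=> // A /nbhs_stone[X [oX [_ FX] XA]].
exact: filterS XA FX.
Qed.

Lemma stone_hausdorff : hausdorff_space stone.
Proof.
rewrite open_hausdorff => p q /eqP pq.
have [X [oX pX qX]] : exists X, [/\ lunif X, sval p X & sval q (~` X)].
  apply: contrapT => H; apply: pq; apply: stone_eq => X oX pX.
  apply: contrapT => nqX; apply: H; exists X; split=> //.
  by rewrite -[sval q _]/(clopen (~` X) q) clopenC.
exists (clopen X, clopen (~` X)); first by rewrite !inE.
split; [exact: open_clopen|exact/open_clopen/lunifC|].
by rewrite /= clopenC // setICr.
Qed.

Lemma is_stone_act g p : is_stone [set X | sval p (ltrans g X)].
Proof.
case: p => p [pl pC pI pS]; split=> /= [X /pl|X oX|X Y pX pY|X Y oY XY].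
- by move=> /(lunif_ltrans (g^-1)%g); rewrite ltransK.
- exact/pC/lunif_ltrans.
- exact: pI.
- by apply: pS => [|x]; [exact: lunif_ltrans|exact: XY].
Qed.

Definition stone_act g p : stone := exist _ _ (is_stone_act g p).

(** Joint continuity is where left uniformity enters: [ltrans h X] does not
    depend on [h] near a given [g]. *)
Lemma stone_actP : is_continuous_action stone_act.
Proof.
split=> [p|g h p|[g p] A /= /nbhs_stone[X [oX pX XA]]].
- by apply: stone_eq => X _ /=; rewrite ltrans1.
- by apply: stone_eq => X _ /=; rewrite ltransM.
exists ([set h | forall x, X (h * g^-1 * x)%g <-> X x], clopen (ltrans g X)) => /=.
  split.
    have := @continuous_mulr (g^-1)%g g; rewrite /continuous_at mulgV.
    by move=> /(_ _ oX).
  by apply/nbhs_stone; exists (ltrans g X); split=> //; exact: lunif_ltrans.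
move=> [h q] [/= hX qX]; apply: XA; rewrite /clopen /=.
suff -> : ltrans h X = ltrans g X by [].
by apply/seteqP; split=> x; rewrite /ltrans /= -(hX (g * x)%g) mulgA mulgVK.
Qed.

Definition mean (R : realType) (m : set G -> R) :=
  [/\ m setT = 1%R, forall X, lunif X -> (0 <= m X)%R,
      forall X Y, lunif X -> lunif Y -> X `&` Y = set0 ->
        m (X `|` Y) = (m X + m Y)%R
    & forall g X, lunif X -> m (ltrans g X) = m X].

(** An invariant measure on the Stone space is read on its clopen sets. *)
Lemma amenable_mean (R : realType) :
  amenable R G -> exists m : set G -> R, mean m.
Proof.
move=> /(_ stone stone_act stone_compact stone_hausdorff stone_actP)[P Pinv].
have mP X : lunif X ->
    measurable (clopen X : set (g_sigma_algebraType (@open stone))).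
  by move=> oX; apply: sub_sigma_algebra; exact: open_clopen.
exists (fun X => fine (P (clopen X))); split.
- by rewrite clopenT probability_setT.
- by move=> X oX; apply: fine_ge0.
- move=> X Y oX oY XY; rewrite clopenU // measureU; [|exact: mP|exact: mP|].
    by rewrite fineD // fin_num_measure //; exact: mP.
  rewrite -clopenI // XY; rewrite -setCT clopenC; last exact: lunifT.
  by rewrite clopenT setCT.
- move=> g X oX; congr fine; rewrite -[RHS](Pinv g) //.
  exact: mP.
Qed.

End LeftUniform.

(** * Small symmetric generic sets *)

Section MassicotWagner.
Variables (G : topologicalGroupType) (R : realType) (m : set G -> R).
Hypothesis meanm : mean m.
Local Open Scope ring_scope.
Implicit Types (X Y Z B S : set G) (g h : G).

Let mT : m setT = 1. Proof. by case: meanm. Qed.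

Let m_ge0 X : lunif X -> 0 <= m X. Proof. by case: meanm => _ + _ _; apply. Qed.

Let mD X Y : lunif X -> lunif Y -> X `&` Y = set0 -> m (X `|` Y) = m X + m Y.
Proof. by case: meanm => _ _ + _; apply. Qed.

Let m_ltrans g X : lunif X -> m (ltrans g X) = m X.
Proof. by case: meanm => _ _ _; apply. Qed.

Lemma mean_setID X Y : lunif X -> lunif Y -> m X = m (X `&` Y) + m (X `\` Y).
Proof.
move=> oX oY; rewrite -{1}(setUIDK X Y) mD //; [exact: lunifI|exact: lunifD|].
by apply/seteqP; split=> // x [[_ ?] []].
Qed.

Lemma mean_sub X Y : lunif X -> lunif Y -> X `<=` Y -> m X <= m Y.
Proof.
move=> oX oY XY; rewrite (mean_setID oY oX) setIC setIidl // lerDl.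
exact/m_ge0/lunifD.
Qed.

Lemma mean_le1 X : lunif X -> m X <= 1.
Proof. by move=> oX; rewrite -mT mean_sub //; exact: lunifT. Qed.

Lemma mean0 : m set0 = 0.
Proof.
have l0 := @lunif0 G.
by have := mean_setID l0 l0; rewrite set0I set0D; lra.
Qed.

Lemma mean_setUI X Y : lunif X -> lunif Y -> m (X `|` Y) = m X + m Y - m (X `&` Y).
Proof.
move=> oX oY; have -> : X `|` Y = X `|` (Y `\` X).
  by apply/seteqP; split=> x [Xx|];
    [left|have [] := pselect (X x); [left|right]|left|case; right].
rewrite mD //; [|exact: lunifD|].
  by rewrite [m Y](mean_setID oY oX) setIC; lra.
by apply/seteqP; split=> // x [? []].
Qed.

Lemma mean_setU_le X Y : lunif X -> lunif Y -> m (X `|` Y) <= m X + m Y.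
Proof. by move=> oX oY; rewrite mean_setUI // gerBl; exact/m_ge0/lunifI. Qed.

Lemma mean_gt0_nonempty X : 0 < m X -> X !=set0.
Proof.
by move=> mX; apply/set0P/eqP => X0; move: mX; rewrite X0 mean0 ltxx.
Qed.

Lemma mean_mulset_ge B X : lunif B -> lunif X -> 0 < m B -> m X <= m (mulset B X).
Proof.
move=> oB oX /mean_gt0_nonempty[b Bb].
rewrite -(m_ltrans (b^-1)%g oX); apply: mean_sub => [||x Xx].
- exact: lunif_ltrans.
- exact: lunif_mulset.
- by exists b => //; exists (b^-1 * x)%g => //; rewrite mulVKg.
Qed.

Definition divset X : set G := [set (x * y^-1)%g | x in X & y in X].

Definition generic S :=
  exists l : seq G, forall g, exists2 h, h \in l & S (h^-1 * g)%g.

(** Otherwise one could shrink [B] again and again, the mean of [mulset B X]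
    decreasing each time by a fixed amount, although it is at least [m X]. *)
Lemma stable_subset X (d : R) : lunif X -> 0 < m X -> 0 < d ->
  exists B, [/\ lunif B, B `<=` X, 0 < m B & forall B', lunif B' -> B' `<=` B ->
    m B ^+ 2 / 4 <= m B' -> (1 - d) * m (mulset B X) <= m (mulset B' X)].
Proof.
move=> oX mX d0; apply: contrapT => H.
have {H}step B : lunif B -> B `<=` X -> 0 < m B -> exists B',
    [/\ lunif B', B' `<=` X, 0 < m B'
      & m (mulset B' X) <= m (mulset B X) - d * m X].
  move=> oB BX mB; apply: contrapT => nB; apply: H; exists B.
  split=> // B' oB' B'B mB'.
  rewrite leNgt; apply/negP => lt; apply: nB; exists B'; split=> //.
  - exact: subset_trans BX.
  - by apply: lt_le_trans mB'; rewrite divr_gt0 // exprn_gt0.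
  - have := mean_mulset_ge oB oX mB; nra.
have {}step n : exists B, [/\ lunif B, B `<=` X, 0 < m B &
    m (mulset B X) <= 1 - n%:R * (d * m X)].
  elim: n => [|n [B [oB BX mB BXn]]].
    exists X; split=> //; rewrite mul0r subr0; exact/mean_le1/lunif_mulset.
  have [B' [oB' B'X mB' B'Xn]] := step B oB BX mB.
  by exists B'; split=> //; rewrite -natr1; nra.
have dX : 0 < d * m X by rewrite mulr_gt0.
pose n := (Num.truncn (d * m X)^-1).+1.
have [B [oB BX mB BXn]] := step n.
have n1 : 1 < n%:R * (d * m X).
  by rewrite -ltr_pdivrMr // div1r; apply: truncnS_gt.
by have := mean_mulset_ge oB oX mB; lra.
Qed.

Definition cover_by B (l : seq G) : set G :=
  [set x | exists2 h, h \in l & B (h^-1 * x)%g].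

Lemma cover_by_cons B h l : cover_by B (h :: l) = ltrans (h^-1)%g B `|` cover_by B l.
Proof.
apply/seteqP; split=> x.
  by case=> k; rewrite inE => /orP[/eqP-> ?|? ?]; [left|right; exists k].
case=> [?|[k kl ?]]; first by exists h => //; rewrite inE eqxx.
by exists k => //; rewrite inE kl orbT.
Qed.

Lemma lunif_cover_by B l : lunif B -> lunif (cover_by B l).
Proof.
move=> oB; elim: l => [|h l IH].
  by rewrite (_ : cover_by _ _ = set0); [exact: lunif0|apply/seteqP; split=> // x []].
by rewrite cover_by_cons; apply: lunifU IH; apply: lunif_ltrans.
Qed.

Lemma mean_cover_by_le B l : lunif B -> m (cover_by B l) <= (size l)%:R * m B.
Proof.
move=> oB; elim: l => [|h l IH].
  by rewrite (_ : cover_by _ _ = set0) ?mean0 ?mul0r //; apply/seteqP; split=> // x [].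
rewrite cover_by_cons; have oB' := lunif_ltrans (h^-1)%g oB.
have := mean_setU_le oB' (lunif_cover_by l oB).
by rewrite m_ltrans //= -natr1; lra.
Qed.

Lemma mean_overlap_le B (s : R) g l : lunif B ->
  (forall h, h \in l -> m (B `&` ltrans (h^-1 * g)%g B) <= s) ->
  m (ltrans (g^-1)%g B `&` cover_by B l) <= (size l)%:R * s.
Proof.
move=> oB; elim: l => [|h l IH] H.
  by rewrite (_ : _ `&` _ = set0) ?mean0 ?mul0r //; apply/seteqP; split=> // x [_ []].
rewrite cover_by_cons setIUr.
have oB' k := lunif_ltrans k oB.
have := mean_setU_le (lunifI (oB' (g^-1)%g) (oB' (h^-1)%g))
  (lunifI (oB' (g^-1)%g) (lunif_cover_by l oB)).
have := IH (fun k kl => H k (mem_behead (s := h :: l) kl)).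
have := H h (mem_head _ _).
rewrite -(m_ltrans g (lunifI (oB' (g^-1)%g) (oB' (h^-1)%g))).
have -> : ltrans g (ltrans (g^-1)%g B `&` ltrans (h^-1)%g B) =
    B `&` ltrans (h^-1 * g)%g B.
  by apply/seteqP; split=> x; rewrite /ltrans /= ?mulKg ?mulgA.
by rewrite /= -natr1; lra.
Qed.

(** Translates of [B] with small pairwise overlaps would, by inclusion and
    exclusion, have a union of mean at least [n t - n ^ 2 s / 2] where
    [s = t ^ 2 / 4]; this exceeds [1] when [n t] is between [2] and [3]. *)
Lemma overlap_generic B : lunif B -> 0 < m B ->
  generic [set g | m B ^+ 2 / 4 <= m (B `&` ltrans g B)].
Proof.
move=> oB; set t := m B => t0; set s := t ^+ 2 / 4; apply: contrapT => H.
have {}H (l : seq G) : exists g, forall h, h \in l ->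
    m (B `&` ltrans (h^-1 * g)%g B) <= s.
  apply: contrapT => nl; apply: H; exists l => g; apply: contrapT => ng.
  apply: nl; exists g => h hl; rewrite leNgt; apply/negP => lt.
  by apply: ng; exists h => //; exact: ltW.
have {H} N n : exists2 l : seq G, size l = n &
    n%:R * t - n%:R ^+ 2 * s / 2 <= m (cover_by B l).
  elim: n => [|n [l ln IH]].
    exists [::] => //; rewrite mul0r expr0n !mul0r subr0.
    exact/m_ge0/lunif_cover_by.
  have [g gl] := H l; exists (g :: l); first by rewrite /= ln.
  rewrite cover_by_cons mean_setUI; [|exact: lunif_ltrans|exact: lunif_cover_by].
  rewrite m_ltrans // -/t -natr1.
  have s0 : 0 <= s by rewrite divr_ge0 ?sqr_ge0.
  have := mean_overlap_le oB gl; rewrite ln -/s.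
  move: IH s0; move: (m _) (m _) (n%:R) => u v k; clearbody s t; lra.
have t1 : t <= 1 by exact: mean_le1.
have exn : exists n, 2 <= n%:R * t.
  exists (Num.truncn (2 / t)).+1; rewrite -ler_pdivrMr //.
  by apply/ltW/truncnS_gt.
case: (ex_minnP exn) => n n2 nmin.
have n3 : n%:R * t <= 3.
  case: n nmin {n2} => [|n] nmin; first by rewrite mul0r.
  have : n%:R * t < 2 by rewrite ltNge; apply/negP => /nmin; rewrite ltnn.
  by rewrite -natr1; lra.
have [l _] := N n; have := mean_le1 (lunif_cover_by l oB); rewrite /s; nra.
Qed.

Definition mulset4 S := mulset (mulset S S) (mulset S S).

Definition symmetric_set S := forall g, S g -> S (g^-1)%g.

(** Massicot and Wagner's argument: with [B] as in [stable_subset], the set of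
    the [g] for which [B] overlaps its translate by [g] substantially moves
    [mulset B X] only by a small proportion of its mean, so that products of
    eight such elements do not move it off itself. *)
Lemma massicot_wagner X : lunif X -> 0 < m X -> exists S,
  [/\ [/\ lunif S, S 1%g & symmetric_set S], generic S, 0 < m S
    & mulset (mulset4 S) (mulset4 S) `<=` divset (mulset X X)].
Proof.
move=> oX mX; have [|B [oB BX mB stB]] := @stable_subset X (1 / 16) oX mX; first lra.
pose S := [set g | m B ^+ 2 / 4 <= m (B `&` ltrans g B)].
have oS : lunif S.
  apply: (@filterS _ (nbhs (1 : G)%g)) oB => u uB g; rewrite /S /= ltransM.
  by have -> : ltrans u B = B by apply/seteqP; split=> x /uB.
have genS := overlap_generic oB mB.
have mS : 0 < m S.
  have [l lP] := genS.
  have := mean_cover_by_le l oS.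
  have -> : cover_by S l = setT by apply/seteqP; split=> // g _; exact: lP.
  rewrite mT => H; rewrite lt_neqAle m_ge0 // andbT eq_sym.
  by apply/eqP => S0; move: H; rewrite S0 mulr0 ler10.
exists S; split=> //.
  split=> //.
    rewrite /S /= ltrans1 setIid; have := mean_le1 oB; nra.
  move=> g; rewrite /S /= => H; apply: le_trans H _.
  rewrite -[leRHS](m_ltrans g); last by apply: lunifI => //; exact: lunif_ltrans.
  apply: mean_sub; [by apply: lunifI => //; exact: lunif_ltrans|
    by apply/lunif_ltrans/lunifI => //; exact: lunif_ltrans|].
  by move=> x; rewrite /ltrans /= mulKg => -[].
(* For [g] in [S] the set [mulset (B `&` ltrans g B) X] lies in [Y] and in
   [ltrans g Y], and its mean is at least fifteen sixteenths of that of [Y]. *)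
set Y := mulset B X; have oY : lunif Y := lunif_mulset X oB.
have mY : 0 < m Y by apply: lt_le_trans (mean_mulset_ge oB oX mB).
pose moves c := [set g | m (Y `\` ltrans g Y) <= c * m Y].
have moves1 : S `<=` moves (1 / 16).
  move=> g Sg; rewrite /moves /=.
  have := stB _ (lunifI oB (lunif_ltrans g oB)) (@subIsetl _ _ _) Sg.
  have := mean_setID oY (lunif_ltrans g oY).
  have : m (mulset (B `&` ltrans g B) X) <= m (Y `&` ltrans g Y).
    apply: mean_sub => [||_ [b [Bb gb] [x Xx <-]]].
    - exact/lunif_mulset/lunifI/lunif_ltrans.
    - exact/lunifI/lunif_ltrans.
    - split; first by exists b => //; exists x.
      by exists (g * b)%g => //; exists x => //; rewrite mulgA.
  by rewrite -/Y; lra.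
have movesM c S1 : S1 `<=` moves c -> mulset S1 S1 `<=` moves (c + c).
  move=> S1c _ [g /S1c gc [h /S1c hc <-]]; move: gc hc; rewrite /moves /= => gc hc.
  have l1 := lunif_ltrans g oY; have l2 := lunif_ltrans h oY.
  have l3 := lunif_ltrans h l1.
  have : m (Y `\` ltrans (g * h)%g Y) <=
      m (Y `\` ltrans h Y) + m (ltrans h (Y `\` ltrans g Y)).
    rewrite ltransM.
    apply: le_trans (mean_setU_le (lunifD oY l2) (lunif_ltrans h (lunifD oY l1))).
    apply: mean_sub; first exact: lunifD.
      by apply: lunifU; [exact: lunifD|exact/lunif_ltrans/lunifD].
    move=> x [Yx nx].
    by have [?|?] := pselect (ltrans h Y x); [right|left].
  rewrite m_ltrans; last exact: lunifD.
  by lra.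
have {}movesM := movesM _ _ (movesM _ _ (movesM _ _ moves1)).
move=> g /movesM; rewrite /moves /= => gY.
have [|y [[b Bb [x Xx bxy]] [b' Bb' [x' Xx' bxy']]]] :=
    @mean_gt0_nonempty (Y `&` ltrans g Y).
  by have := mean_setID oY (lunif_ltrans g oY); lra.
exists (g * y)%g; first by rewrite -bxy'; exists b'; [exact: BX|exists x'].
exists y; last by rewrite mulgK.
by rewrite -bxy; exists b; [exact: BX|exists x].
Qed.

Lemma mulset_sub X Y X' Y' : X `<=` X' -> Y `<=` Y' -> mulset X Y `<=` mulset X' Y'.
Proof. by move=> XX YY _ [x /XX ? [y /YY ? <-]]; exists x => //; exists y. Qed.

Lemma sub_mulset X Y : Y 1%g -> X `<=` mulset X Y.
Proof. by move=> Y1 x Xx; exists x => //; exists 1%g => //; rewrite mulg1. Qed.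

Lemma mulset_symmetric S : symmetric_set S -> symmetric_set (mulset S S).
Proof.
move=> sS _ [x /sS ? [y /sS ? <-]]; exists (y^-1)%g => //.
by exists (x^-1)%g => //; rewrite invgM.
Qed.

(** Iterate [massicot_wagner], each time for the set [S] obtained before. For
    symmetric [S] the set [divset (mulset S S)] is [mulset4 S], so that the
    sets [mulset4 S] form the required chain. *)
Lemma generic_chain X : lunif X -> 0 < m X -> exists Q : nat -> set G,
  [/\ forall n, [/\ lunif (Q n), Q n 1%g & symmetric_set (Q n)],
      forall n, generic (Q n), forall n, mulset (Q n.+1) (Q n.+1) `<=` Q n
    & Q 0%N `<=` divset (mulset X X)].
Proof.
move=> oX mX.
pose wide := {S : set G | lunif S /\ 0 < m S}.
pose fine (S S' : wide) := [/\ sval S' 1%g, symmetric_set (sval S'), generic (sval S')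
  & mulset (mulset4 (sval S')) (mulset4 (sval S')) `<=`
    divset (mulset (sval S) (sval S))].
have : forall S : wide, exists S' : wide, fine S S'.
  move=> [S [oS mS]].
  have [S' [[oS' S'1 symS'] genS' mS' S'P]] := massicot_wagner oS mS.
  by exists (exist _ S' (conj oS' mS') : wide).
move=> /choice[F FP]; pose T n := iter n F (exist _ X (conj oX mX) : wide).
pose Q n := mulset4 (sval (T n.+1)).
have SQ n : sval (T n.+1) `<=` Q n.
  have [T1 _ _ _] := FP (T n).
  apply: (subset_trans (sub_mulset T1)); apply: sub_mulset.
  by exists 1%g => //; exists 1%g => //; rewrite mulg1.
exists Q; split=> [n|n|n|].
- have [T1 symT _ _] := FP (T n); split.
  + by do 2 apply: lunif_mulset; case: (svalP (T n.+1)).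
  + exact: (SQ n _ T1).
  + by do 2 apply: mulset_symmetric.
- have [_ _ [l lP] _] := FP (T n); exists l => g.
  by have [h ? /SQ ?] := lP g; exists h.
- have [_ _ _ QP] := FP (T n.+1); have [_ symT _ _] := FP (T n).
  apply: (subset_trans QP) => _ [x TTx [y TTy <-]].
  by exists x => //; exists (y^-1)%g => //; apply: mulset_symmetric TTy.
- have [T1 _ _ QP] := FP (T 0%N); apply: subset_trans QP.
  by apply: sub_mulset; apply: (SQ 0%N _ T1).
Qed.

End MassicotWagner.

(** * Subgroups of the group of points *)

Section Points.
Variables (L : language) (M : structure L) (G : topologicalGroupType).
Variable D : definable_group M G.
Variables (K : Type) (C : structure L) (j : M -> C).
Hypothesis elj : elementary_embedding j.
Hypothesis limK : uncountable_strong_limit K.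
Hypothesis smallM : small K M.
Hypothesis satC : saturated K C.
Local Notation n := (gdim D).
Local Notation gst := (gpoint D elj).
Local Notation incl := (gincl D elj).
Local Notation coord := (@gcoord L M G D C j elj).
Local Notation st := (@starG L M G D C j elj).
Local Notation env := (genv j coord).
Local Notation transfer := (@transfer L M G D C j elj).

Definition infinitesimal : set gst := [set x | forall U, open U -> U 1%g -> st U x].

Lemma st_cover_by (S : set G) (l : seq G) x : lunif S -> st (cover_by S l) x ->
  exists2 h, h \in l & st (ltrans (h^-1)%g S) x.
Proof.
move=> oS; elim: l => [|h l IH].
  have -> : cover_by S [::] = set0 by apply/seteqP; split=> // y [].
  have o0 := lunif_open (@lunif0 G).
  by move=> x0; case: (@st_disjoint _ _ _ D _ _ elj set0 set0 x o0 o0 _ x0 x0) => y [].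
have oh := lunif_open (lunif_ltrans (h^-1)%g oS).
have ol := lunif_open (lunif_cover_by l oS).
rewrite cover_by_cons => /(st_setU oh ol)[hx|/IH[k kl kx]].
- by exists h => //; rewrite inE eqxx.
- by exists k => //; rewrite inE kl orbT.
Qed.

(** Let [phi] be a formula over [M] true of [a], and [H] an open subgroup. The
    product of [H] and of the set that [phi] defines in [G] is left uniformly
    open and its star contains [a], hence [b]; so [phi] is true of a translate
    of [b] by a point of the star of [H]. Compactness provides one translate
    that works for all [phi] and [H]. *)
Lemma lunif_type_infinitesimal a b : has_open_subgroup_basis G ->
  (forall X, lunif X -> st X a -> st X b) ->
  exists2 a', same_type (fun _ : unit => a) (fun=> a') & infinitesimal (b * a'^-1)%g.
Proof.
move=> basisG ab.
pose at_ V (phi : formula L (unit * 'I_n + M)) (v : V) : gform D V :=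
  GAt (fren phi (fun u =>
    match u with inl (_, i) => inl (v, i) | inr k => inr k end)).
have atC V phi (v : V) (e : V -> gst) :
    gsatC (at_ V phi v) e = sat phi (env (fun=> e v)).
  by rewrite /gsatC /= sat_fren; congr sat; apply/funext => -[[]|].
have atM V phi (v : V) (e : V -> G) :
    gsatM (at_ V phi v) e = sat phi (genv id (gemb D) (fun=> e v)).
  by rewrite /gsatM /= sat_fren; congr sat; apply/funext => -[[]|].
pose chi phi H (oH : open H) : gform D (option unit) :=
  GAnd (at_ _ phi None)
    (GEx (GAnd (GPred oH None) (GMul None (Some None) (Some (Some tt))))).
have chiE phi H (oH : open H) x :
    sat (gtr (chi phi H oH)) (env (oapp (fun _ : unit => b) x)) <->
    sat phi (env (fun=> x)) /\ exists2 h, st H h & (h * x)%g = b.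
  rewrite sat_gtrC -(atC _ phi None (oapp (fun _ : unit => b) x)).
  by split=> [[? [h [? ?]]]|[? [h ? ?]]]; split=> //; exists h.
pose p := [set psi | exists phi H (oH : open H),
  [/\ sat phi (env (fun=> a)), group_closed [in H] & psi = gtr (chi phi H oH)]].
have [||||x xP] := @compactness _ _ _ _ _ _ _ elj limK smallM satC _
    (fun _ : unit => b) p.
- exact: small_unit.
- exists (gtr (chi (FNot (FFalse L _)) setT openT)), (FNot (FFalse L _)), setT, openT.
  by split=> //; split=> [|? ? _ _]; rewrite inE.
- move=> _ _ [phi [H [oH [aphi gH ->]]]] [psi [H' [oH' [apsi gH' ->]]]].
  exists (gtr (chi (FAnd phi psi) (H `&` H') (openI oH oH'))).
    exists (FAnd phi psi), (H `&` H'), (openI oH oH'); split=> //.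
      by rewrite sat_and.
    split=> [|x y]; rewrite !inE; first by have := gH.1; have := gH'.1; rewrite !inE.
    move=> [Hx H'x] [Hy H'y]; have := gH.2 x y; have := gH'.2 x y; rewrite !inE.
    by split; [apply: H1|apply: H0].
  move=> x /chiE[]; rewrite sat_and => -[phix psix] [h hHH hx].
  have [? ?] : st H h /\ st H' h.
    by split; apply: st_sub hHH => //; [exact: openI|exact: openI|move=> ? []..].
  by split; apply/chiE; split=> //; exists h.
- move=> _ [phi [H [oH [aphi gH ->]]]].
  have Hd g h : H g -> H h -> H (g / h)%g.
    by move=> Hg Hh; have := gH.2 g h; rewrite !inE => /(_ Hg Hh).
  have H1 : H 1%g by have := gH.1; rewrite inE.
  have HV g : H g -> H (g^-1)%g by move=> /(Hd _ _ H1); rewrite div1g.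
  pose X : set G := mulset H [set g | sat phi (genv id (gemb D) (fun=> g))].
  have oX : lunif X.
    apply: lunif_mulset; rewrite /lunif.
    apply: filterS (open_nbhs_nbhs (conj oH H1)) => u Hu x; split=> Hx.
      by have := Hd _ _ (HV _ Hu) (HV _ Hx); rewrite invgK mulKg.
    by have := Hd _ _ Hu (HV _ Hx); rewrite invgK.
  have Xa : st X a.
    apply: (iffLR (transfer
      (GAll (GImp (at_ _ phi None) (GPred (lunif_open oX) None))) id) _ a).
      move=> g; change (gsatM (at_ _ phi None) (oapp id g) -> X g).
      by rewrite atM => gphi; exists 1%g => //; exists g => //; rewrite mul1g.
    change (gsatC (at_ _ phi None) (oapp (incl \o id) a)).
    by rewrite atC.
  have := iffLR (transfer (GAll (GImp (GPred (lunif_open oX) None)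
    (GEx (GEx (GAnd (GPred oH (Some None)) (GAnd (at_ _ phi None)
      (GMul (Some None) None (Some (Some None))))))))) id) _ b (ab _ oX Xa).
  case=> [g /= [h Hh [k kphi hk]]|h [x [Hh [xphi hx]]]].
    exists h, k; split=> //; split=> //.
    change (gsatM (at_ _ phi None) (oapp (oapp (oapp id g) h) k)).
    by rewrite atM.
  exists x; apply/chiE; split; last by exists h.
  have : gsatC (at_ _ phi None) (oapp (oapp (oapp (incl \o id) b) h) x) := xphi.
  by rewrite atC.
have xprop (phi : formula L (unit * 'I_n + M)) H :
    open H -> group_closed [in H] -> sat phi (env (fun=> a)) ->
    sat phi (env (fun=> x)) /\ exists2 h, st H h & (h * x)%g = b.
  by move=> oH gH aphi; apply/chiE; apply: xP; exists phi, H, oH.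
exists x.
  move=> phi; split=> [aphi|xphi].
    have [H [oH gH _]] := basisG setT filterT.
    by have [] := xprop phi H oH gH aphi.
  apply: contrapT => naphi.
  have [H [oH gH _]] := basisG setT filterT.
  by have [nx _] := xprop (FNot phi) H oH gH naphi; apply: nx.
move=> U oU U1.
have [H [oH gH HU]] := basisG U (open_nbhs_nbhs (conj oU U1)).
have [|_ [h Hh hx]] := xprop (FNot (FFalse L _)) H oH gH; first by [].
by rewrite -hx mulgK; apply: st_sub Hh.
Qed.

(** Each [X] alone provides a factorization of [w]; by compactness one
    factorization serves all the members of a directed family. *)
Lemma st_bigcap_mulset (p : set (set G)) (A B E : set G -> set G) w :
  p !=set0 -> (forall X Y, p X -> p Y -> p (X `&` Y)) ->
  (forall X, p X -> [/\ open (A X), open (B X) & open (E X)]) ->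
  (forall X Y, X `<=` Y -> A X `<=` A Y /\ B X `<=` B Y) ->
  (forall X, p X -> E X `<=` mulset (A X) (B X)) ->
  (forall X, p X -> st (E X) w) ->
  exists x, forall X, p X -> st (A X) x /\ st (B X) (x^-1 * w)%g.
Proof.
move=> [X0 pX0] pI pO AB EAB Ew.
pose chi U V (oU : open U) (oV : open V) : gform D (option unit) :=
  GAnd (GPred oU None)
    (GEx (GAnd (GPred oV None) (GMul (Some None) None (Some (Some tt))))).
have chiE U V (oU : open U) (oV : open V) x :
    sat (gtr (chi U V oU oV)) (env (oapp (fun _ : unit => w) x)) <->
    st U x /\ st V (x^-1 * w)%g.
  rewrite sat_gtrC; split=> [[Ux [y /= [Vy <-]]]|[Ux Vx]]; first by rewrite mulKg.
  by split=> //; exists (x^-1 * w)%g; split=> //; rewrite /= mulVKg.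
pose q := [set psi | exists X (oA : open (A X)) (oB : open (B X)),
  p X /\ psi = gtr (chi _ _ oA oB)].
have [||||x xP] := @compactness _ _ _ _ _ _ _ elj limK smallM satC _
    (fun _ : unit => w) q.
- exact: small_unit.
- by have [oA oB _] := pO _ pX0; exists (gtr (chi _ _ oA oB)), X0, oA, oB.
- move=> _ _ [X [oA [oB [pX ->]]]] [Y [oA' [oB' [pY ->]]]].
  have pXY := pI _ _ pX pY; have [oAI oBI _] := pO _ pXY.
  exists (gtr (chi _ _ oAI oBI)); first by exists (X `&` Y), oAI, oBI.
  have [AX BX] := AB _ _ (@subIsetl _ X Y).
  have [AY BY] := AB _ _ (@subIsetr _ X Y).
  by move=> x /chiE[Ax Bx]; split; apply/chiE; split;
    [apply: st_sub Ax|apply: st_sub Bx|apply: st_sub Ax|apply: st_sub Bx].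
- move=> _ [X [oA [oB [pX ->]]]]; have [_ _ oE] := pO _ pX.
  have [|x [y [Ax By xy]]] := st_mulP oA oB oE _ (Ew _ pX).
    by move=> g /(EAB _ pX)[x Ax [y By xy]]; exists x, y.
  by exists x; apply/chiE; rewrite -xy mulKg.
exists x => X pX; have [oA oB _] := pO _ pX; apply/(chiE _ _ oA oB).
by apply: xP; exists X, oA, oB.
Qed.

(** A coheir [c] over [a] and [v] is in the coset of [a], and it conjugates [v]
    into the star of each [U] in [F] because all the elements of [G] do. *)
Lemma conj_infinitesimal (P : set gst) (F : set (set G)) a v :
  gsubgroup P -> type_invariant P -> small_index K P ->
  F `<=` open -> P = \bigcap_(U in F) st U ->
  infinitesimal v -> P (a^-1 * v * a)%g.
Proof.
move=> groupP invP indexP oF PE muv.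
have [W ultraW aW] := realizes_exists a.
have [c cW] := coheir_exists limK smallM satC ultraW (pairf a v) (small_bool limK).
have Pac : P (a^-1 * c)%g.
  exact: (coheir_coset limK smallM satC groupP invP indexP ultraW aW
    (coheir_rename (fun=> false) cW)).
have Pcv : P (c^-1 * v * c)%g.
  rewrite PE => U FU; have oU := oF _ FU.
  have U1 : U 1%g.
    have := groupP.1; rewrite PE => /(_ _ FU) U1.
    exact: (iffLR (st_incl D elj 1%g oU) U1).
  pose psi : gform D (option bool) := GEx (GEx
    (GAnd (GMul (Some (Some (Some true))) (Some (Some None)) None)
    (GAnd (GMul (Some (Some None)) (Some None) None) (GPred oU (Some None))))).
  have psiE x : sat (gtr psi) (env (oapp (pairf a v) x)) <-> st U (x^-1 * v * x)%g.
    rewrite sat_gtrC; split=> [[y [z /= [<- [xy Uy]]]]|Ux].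
      by rewrite -mulgA -xy mulKg.
    exists (x^-1 * v * x)%g, (v * x)%g; split=> //; split=> //.
    by rewrite /= -mulgA mulVKg.
  apply: (iffLR (psiE c)); apply: (iffRL (cW (gtr psi))).
  apply: filterE => g; apply: (iffRL (psiE (incl g))).
  have og h : open [set k : G | U (k * h)%g].
    by apply: (open_preimage _ oU); exact: continuous_mulr.
  have og' : open [set k : G | U (g^-1 * k * g)%g].
    by apply: (open_preimage _ (og g)); exact: continuous_mull.
  apply: (st_rmul (og g) oU) => //; rewrite -inclV.
  apply: (st_lmul og' (og g)) => //.
  by apply: muv => //; rewrite /= mulg1 mulVg.
have -> : (a^-1 * v * a = ((a^-1 * c) * (c^-1 * v * c)) * (a^-1 * c)^-1)%g.
  by rewrite invgM invgK !mulgA mulgK mulgK.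
have P_inv x : P x -> P (x^-1)%g.
  by move=> Px; have := groupP.2 _ _ Px groupP.1; rewrite mulg1.
have P_mul x y : P x -> P y -> P (x * y)%g.
  by move=> /P_inv Px /(groupP.2 _ _ Px); rewrite invgK.
exact: (P_mul _ _ (P_mul _ _ Pac Pcv) (P_inv _ Pac)).
Qed.

(** * Subgroups as sets of tuples *)

Implicit Type H : set ('I_n -> C).

Lemma gcoord_surj (c : 'I_n -> C) : Gstar c -> exists x : gst, coord x = c.
Proof. by move=> Gc; exists (exist _ c Gc). Qed.

Lemma star_subgroupP H : H `<=` @Gstar L M G D C ->
  star_subgroup j H <-> gsubgroup (H \o coord).
Proof.
move=> HG; split=> [[_ H1 HM HV]|[H1 HD]].
  have HVc (x : gst) : H (coord x) -> H (coord (x^-1)%g).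
    by move=> /HV; apply; apply/(star_mulP x _ 1%g); rewrite mulgV.
  split=> // x y /HVc Hx Hy; apply: HM Hx Hy _; exact/star_mulP.
have HV (x : gst) : H (coord x) -> H (coord (x^-1)%g).
  by move=> Hx; have := HD _ _ Hx H1; rewrite /= mulg1.
split=> //.
- move=> a b c Ha Hb abc; have [_ _ Gc] := star_mul_Gstar elj abc.
  have [x ax] := gcoord_surj (HG _ Ha); have [y bY] := gcoord_surj (HG _ Hb).
  have [z cz] := gcoord_surj Gc; subst a b c.
  by move: abc => /star_mulP <-; have := HD _ _ (HV _ Ha) Hb; rewrite /= invgK.
- move=> a b Ha ab; have [_ Gb _] := star_mul_Gstar elj ab.
  have [x ax] := gcoord_surj (HG _ Ha); have [y bY] := gcoord_surj Gb; subst a b.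
  have /star_mulP/mulg1_eq <- : star_mul (coord x) (coord y) (coord 1%g) := ab.
  exact: HV.
Qed.

Lemma star_lcosetP H (x y : gst) : H `<=` @Gstar L M G D C ->
  star_lcoset (coord x) H (coord y) <-> H (coord (x^-1 * y)%g).
Proof.
move=> HG; split=> [[h Hh]|Hxy].
  by have [z hz] := gcoord_surj (HG _ Hh); subst h => /star_mulP <-; rewrite mulKg.
by exists (coord (x^-1 * y)%g) => //; apply/star_mulP; rewrite mulVKg.
Qed.

Lemma star_rcosetP H (x y : gst) : H `<=` @Gstar L M G D C ->
  star_rcoset H (coord x) (coord y) <-> H (coord (y * x^-1)%g).
Proof.
move=> HG; split=> [[h Hh]|Hxy].
  by have [z hz] := gcoord_surj (HG _ Hh); subst h => /star_mulP <-; rewrite mulgK.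
by exists (coord (y * x^-1)%g) => //; apply/star_mulP; rewrite mulgVK.
Qed.

Lemma star_normalP H : H `<=` @Gstar L M G D C ->
  star_normal H <-> forall x y : gst, H (coord y) <-> H (coord (x * y * x^-1)%g).
Proof.
move=> HG; split=> [norm x y|conj a Ga].
  have := norm (coord x) (svalP x) => /(congr1 (fun A => A (coord (x * y)%g))) E.
  rewrite -(star_rcosetP x (x * y)%g HG) -E.
  by apply: iff_sym; rewrite (star_lcosetP x (x * y)%g HG) mulKg.
have [x ax] := gcoord_surj Ga; subst a.
have cosetG (A : set ('I_n -> C)) (c : 'I_n -> C) :
    (exists2 h, A h & star_mul (coord x) h c \/ star_mul h (coord x) c) -> Gstar c.
  by case=> h _ [] /(star_mul_Gstar elj)[].
apply/seteqP; split=> c cH; have [|y cy] := @gcoord_surj c.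
- by apply: (cosetG H); case: cH => h Hh ?; exists h => //; left.
- subst c; move: cH => /(star_lcosetP _ _ HG) /(conj x) H'.
  by apply/star_rcosetP => //; move: H'; rewrite mulVKg.
- by apply: (cosetG H); case: cH => h Hh ?; exists h => //; right.
- subst c; move: cH => /(star_rcosetP _ _ HG) => H'.
  by apply/star_lcosetP => //; apply/(conj x); rewrite mulVKg.
Qed.

Lemma star_lcoset_eq H (x y : gst) : star_subgroup j H ->
  star_lcoset (coord x) H = star_lcoset (coord y) H <-> H (coord (x^-1 * y)%g).
Proof.
move=> sH; have HG : H `<=` @Gstar L M G D C by case: sH.
have [H1 HD] := (star_subgroupP HG).1 sH.
have HV (z : gst) : H (coord z) -> H (coord (z^-1)%g).
  by move=> Hz; have := HD _ _ Hz H1; rewrite /= mulg1.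
split=> [E|Hxy].
  apply/star_lcosetP => //; rewrite E; apply/star_lcosetP => //; by rewrite mulVg.
have sub (u v : gst) : H (coord (u^-1 * v)%g) ->
    star_lcoset (coord u) H `<=` star_lcoset (coord v) H.
  move=> Huv c uc; have [w cw] : exists w : gst, coord w = c.
    by apply: gcoord_surj; case: uc => h _ /(star_mul_Gstar elj)[].
  subst c; move: uc => /(star_lcosetP _ _ HG) Huw; apply/star_lcosetP => //.
  by have := HD _ _ Huv Huw; rewrite /= invgM invgK -mulgA mulVKg.
apply/seteqP; split; apply: sub => //.
by have := HV _ Hxy; rewrite invgM invgK.
Qed.

Lemma bounded_index_small H : star_subgroup j H -> bounded_index K H ->
  small_index K (H \o coord).
Proof.
move=> sH /small_setP bH; set S := [set _ | _ in _] in bH.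
have ex (s : S) : exists x : gst, star_lcoset (coord x) H = \val s.
  have [a Ga <-] := set_mem (valP s).
  by have [x <-] := gcoord_surj Ga; exists x.
have [e eP] := choice ex; exists S, e; split=> // x.
have Sx : S (star_lcoset (coord x) H) by exists (coord x) => //; exact: (svalP x).
by exists (SigSub (mem_set Sx)); apply/star_lcoset_eq => //; rewrite eP.
Qed.

Lemma small_bounded_index H (A : Type) (f : gst -> A) : star_subgroup j H ->
  small K A -> (forall x y, f x = f y -> H (coord (x^-1 * y)%g)) ->
  bounded_index K H.
Proof.
move=> sH sA fH; apply/small_setP; set S := [set _ | _ in _].
have ex (s : S) : exists x : gst, star_lcoset (coord x) H = \val s.
  have [a Ga <-] := set_mem (valP s).
  by have [x <-] := gcoord_surj Ga; exists x.
have [e eP] := choice ex.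
apply: (@small_inj _ _ _ (f \o e)) sA => s t /fH /(star_lcoset_eq _ _ sH).
by rewrite !eP => /val_inj.
Qed.

End Points.

(** * Comparing the two components *)

Section Components.
Variables (L : language) (M : structure L) (G : topologicalGroupType).
Variable D : definable_group M G.
Variables (K : Type) (C : structure L) (j : M -> C).
Hypothesis monsterC : monster K j.

Let elj : elementary_embedding j := monster_elementary monsterC.
Let limK := monster_strong_limit monsterC.
Let smallM : small K M := monster_model monsterC.
Let satC := monster_saturated monsterC.
Let homC := monster_homogeneous monsterC.

Local Notation n := (gdim D).
Local Notation gst := (gpoint D elj).
Local Notation incl := (gincl D elj).
Local Notation coord := (@gcoord L M G D C j elj).
Local Notation st := (@starG L M G D C j elj).
Local Notation GstarD := (@Gstar L M G D C).

Implicit Type H : set ('I_n -> C).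

Lemma invariant_type_invariant H : invariant_over_model j H ->
  type_invariant (H \o coord).
Proof.
move=> invH x y x' y' /(same_type_quotient limK smallM homC invH).
by case=> + _; apply.
Qed.

Lemma intersection_invariant H : intersection_of_opens H -> invariant_over_model j H.
Proof.
move=> [F oF ->] s [_ _ srel] _ a.
by split=> Ha U FU; apply/srel; apply: Ha.
Qed.

Lemma intersection_stars H : intersection_of_opens H -> exists2 F : set (set G),
  F `<=` open & H \o coord = \bigcap_(U in F) st U.
Proof. by move=> [F oF ->]; exists F. Qed.

Lemma automorphism_inv (s : C -> C) : automorphism s ->
  exists t : C -> C, cancel s t /\ cancel t s.
Proof. by move=> [[t sK tK] _ _]; exists t. Qed.

(** The normal core of [H]. *)
Definition gcore H : set ('I_n -> C) :=
  [set coord x | x in [set x : gst | forall a : gst, H (coord (a^-1 * x * a)%g)]].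

Lemma gcoreP H (x : gst) :
  gcore H (coord x) <-> forall a : gst, H (coord (a^-1 * x * a)%g).
Proof. by split=> [[y Hy /gcoord_inj <-]//|Hx]; exists x. Qed.

Lemma gcore_Gstar H : gcore H `<=` GstarD.
Proof. by move=> _ [x _ <-]; exact: (svalP x). Qed.

Lemma gcore_sub H : gcore H `<=` H.
Proof. by move=> _ [x /(_ 1%g) + <-]; rewrite invg1 mul1g mulg1. Qed.

Section Core.
Variable H : set ('I_n -> C).
Hypothesis subH : star_subgroup j H.

Let HG : H `<=` GstarD. Proof. by case: subH. Qed.
Let groupH : gsubgroup (H \o coord). Proof. exact/star_subgroupP. Qed.

Lemma gcore_subgroup : star_subgroup j (gcore H).
Proof.
apply/(star_subgroupP elj); first exact: gcore_Gstar.
have [H1 HD] := groupH; split=> [|x y /gcoreP Hx /gcoreP Hy]; apply/gcoreP => a.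
  by rewrite mulg1 mulVg.
have := HD _ _ (Hx a) (Hy a).
by rewrite /= !invgM invgK -!mulgA mulVKg.
Qed.

Lemma gcore_normal : star_normal (gcore H).
Proof.
apply/(star_normalP elj); first exact: gcore_Gstar.
move=> x y; split=> /gcoreP Hy; apply/gcoreP => a.
  by have := Hy (x^-1 * a)%g; rewrite invgM invgK !mulgA.
have := Hy (x * a)%g.
by rewrite invgM !mulgA mulgVK -[(_ * x^-1 * x)%g]mulgA mulVg mulg1.
Qed.

(** A coset of the core is determined by the permutation that it induces on
    the cosets of [H]. *)
Lemma gcore_bounded : bounded_index K H -> bounded_index K (gcore H).
Proof.
move=> /small_setP; set S := [set _ | _ in _] => smallS.
have Sx (x : gst) : S (star_lcoset (coord x) H).
  by exists (coord x) => //; exact: (svalP x).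
pose cls x : S := SigSub (mem_set (Sx x)).
have clsE x y : cls x = cls y -> H (coord (x^-1 * y)%g).
  by move=> /(congr1 val) /= /(star_lcoset_eq _ _ subH).
apply: (small_bounded_index (elj := elj)
  (f := fun x => [set q | exists a, q = (cls a, cls (x * a)%g)])) gcore_subgroup _ _.
  exact: (small_set limK (small_prod limK smallS smallS)).
move=> x y /= E; apply/gcoreP => a.
have : [set q | exists a, q = (cls a, cls (y * a)%g)] (cls a, cls (x * a)%g).
  by rewrite -E; exists a.
case=> b bE; have ab := clsE _ _ (congr1 fst bE).
have xy := clsE _ _ (congr1 snd bE).
have [H1 HD] := groupH.
have HV (z : gst) : H (coord z) -> H (coord (z^-1)%g).
  by move=> Hz; have := HD _ _ Hz H1; rewrite /= mulg1.
have := HD _ _ (HV _ xy) (HV _ ab); rewrite /= invgK !invgM invgK => Hxa.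
by move: Hxa; rewrite !mulgA mulgK -!mulgA.
Qed.

Lemma gcore_invariant : invariant_over_model j H -> invariant_over_model j (gcore H).
Proof.
move=> invH s auts sj a.
have [t [sK tK]] := automorphism_inv auts.
have GsE (c : 'I_n -> C) : GstarD (s \o c) <-> GstarD c.
  exact: (sat_automorphism (gdom D) c auts).
pose act (x : gst) : gst :=
  exist _ (s \o coord x) (iffRL (GsE (coord x)) (svalP x)).
have actM x y : (act x * act y)%g = act (x * y)%g.
  apply/star_mulP; have /star_mulP : (x * y)%g = (x * y)%g by [].
  rewrite /star_mul -(sat_automorphism (gmul D) _ auts); congr sat.
  by apply/funext => -[[|]|].
have actJ x b : act (b^-1 * x * b)%g = ((act b)^-1 * act x * act b)%g.
  have E : (act b * act (b^-1 * x * b) = act x * act b)%g.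
    by rewrite !actM -mulgA mulVKg.
  by rewrite -[RHS]mulgA -E mulKg.
have act_surj y : exists b, act b = y.
  have Gt : GstarD (t \o coord y).
    apply/GsE; rewrite (_ : s \o (t \o coord y) = coord y); first exact: (svalP y).
    by apply/funext => i; exact: tK.
  exists (exist _ _ Gt); apply: gcoord_inj; apply/funext => i; exact: tK.
have HJ x b : H (coord ((act b)^-1 * act x * act b)%g) <-> H (coord (b^-1 * x * b)%g).
  rewrite -actJ; exact: invH.
split=> [[x Hx xsa]|[x Hx <-]].
  have Ga : GstarD a by apply/GsE; rewrite -xsa; exact: (svalP x).
  have [z za] := gcoord_surj elj Ga; subst a.
  have xz : x = act z by exact: gcoord_inj.
  by apply/gcoreP => b; apply/HJ; rewrite -xz.
apply/(gcoreP H (act x)) => b'; have [b <-] := act_surj b'; exact/HJ.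
Qed.

End Core.

Lemma star_mu_infinitesimal c : @star_mu L M G D C c ->
  exists2 x : gst, coord x = c & infinitesimal x.
Proof.
move=> muc; have Gc : GstarD c.
  by apply: (star_Gstar elj openT); apply: muc; split; [exact: openT|].
have [x xc] := gcoord_surj elj Gc; exists x => // U oU U1.
by rewrite /starG /= xc; apply: muc.
Qed.

(** The normal core of a bounded index intersection of stars [H] is one of the
    subgroups whose intersection is the smallest invariant one: it contains the
    infinitesimals because their conjugates are in [H]. *)
Lemma G000top_sub : G000top D K j `<=` G00top D K j.
Proof.
move=> c cG H [[subH bH intH] _].
have HG : H `<=` GstarD by case: subH.
have invH := intersection_invariant intH.
apply: gcore_sub; apply: cG; split.
  split; [exact: gcore_subgroup|exact: gcore_normal|exact: gcore_bounded|].
  exact: gcore_invariant.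
move=> _ /star_mu_infinitesimal[x <- mux]; apply/gcoreP => a.
have [F oF HF] := intersection_stars intH.
apply: (conj_infinitesimal limK smallM satC (P := H \o coord) (F := F)) => //.
- exact/star_subgroupP.
- exact: invariant_type_invariant.
- exact: bounded_index_small.
Qed.

Lemma small_group : small K G.
Proof.
exact: small_inj (@gemb_inj _ _ _ D) (small_fun limK (small_ord limK n) smallM).
Qed.

(** A coset of the intersection of a chain as in [generic_chain] is determined
    by the open sets whose stars contain a given representative, and there are
    few sets of open sets. *)
Lemma G00top_chain (Q : nat -> set G) :
  (forall k, [/\ lunif (Q k), Q k 1%g & symmetric_set (Q k)]) ->
  (forall k, generic (Q k)) -> (forall k, mulset (Q k.+1) (Q k.+1) `<=` Q k) ->
  G00top D K j `<=` star (Q 0).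
Proof.
move=> QP genQ Qmul c cG.
have oQ k : open (Q k) by have [/lunif_open] := QP k.
pose T : set ('I_n -> C) := \bigcap_(U in range Q) star U.
have TE (x : gst) : (forall k, st (Q k) x) -> T (coord x).
  by move=> Qx _ [k _ <-]; exact: Qx.
have Tst (x : gst) k : T (coord x) -> st (Q k) x.
  by move=> Tx; apply: Tx; exists k.
have TG : T `<=` GstarD.
  by move=> d Td; apply: (star_Gstar elj (oQ 0)); apply: Td; exists 0.
have QV k (x y : gst) : st (Q k.+1) x -> st (Q k.+1) y -> st (Q k) (x^-1 * y)%g.
  have [_ _ symQ] := QP k.+1; move=> Qx; apply: (st_mul (oQ k.+1) (oQ k.+1) (oQ k)).
    by move=> g h Qg Qh; apply: Qmul; exists g => //; exists h.
  exact: (st_inv (oQ k.+1) (oQ k.+1) symQ Qx).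
have subT : star_subgroup j T.
  apply/(star_subgroupP elj TG); split.
    by apply: TE => k; apply/(st_incl D elj 1%g (oQ k)); have [] := QP k.
  by move=> x y Tx Ty; apply: TE => k; apply: QV; apply: Tst.
have : T c; last by apply; exists 0.
apply: cG; split=> //; split=> //.
  apply: (small_bounded_index
    (f := fun x : gst => [set U | open U /\ st U x])) subT _ _.
    exact: (small_set limK (small_set limK small_group)).
  move=> x y xy; apply: TE => k.
  have [l lP] := genQ k.+1.
  have cover : st (cover_by (Q k.+1) l) x.
    rewrite (_ : cover_by _ _ = setT); first exact: st_setT.
    by apply/seteqP; split=> // g _; exact: lP.
  have [lQ _ _] := QP k.+1.
  have [h _ hx] := st_cover_by lQ cover.
  have oh := lunif_open (lunif_ltrans (h^-1)%g lQ).
  have hy : st (ltrans (h^-1)%g (Q k.+1)) y.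
    have : [set U | open U /\ st U x] (ltrans (h^-1)%g (Q k.+1)) by [].
    by rewrite xy => -[].
  have translate z : st (ltrans (h^-1)%g (Q k.+1)) z ->
      st (Q k.+1) (incl (h^-1)%g * z)%g.
    exact: st_lmul.
  have := QV _ _ _ (translate _ hx) (translate _ hy).
  by rewrite invgM -mulgA mulKg.
by exists (range Q) => // _ [k _ <-].
Qed.

(** The ultrafilter extends the filter of sets containing a left uniformly
    open set of mean one, so that it contains no null set. *)
Lemma wide_ultrafilter (R : realType) (m : set G -> R) : mean m ->
  exists2 W : set_system G, UltraFilter W & forall X, lunif X -> W X -> (0 < m X)%R.
Proof.
move=> meanm; have [mT m_ge0 _ _] := meanm.
pose F : set_system G := [set A | exists X, [/\ lunif X, m X = 1%R & X `<=` A]].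
have FF : ProperFilter F.
  split=> [[X [oX mX X0]]|].
    have X00 : X = set0 by apply/seteqP; split.
    by move: mX; rewrite X00 (mean0 meanm) => /eqP; rewrite eq_sym oner_eq0.
  split=> [|A B [X [oX mX XA]] [Y [oY mY YB]]|A B AB [X [oX mX XA]]].
  - by exists setT; split=> //; exact: lunifT.
  - exists (X `&` Y); split; [exact: lunifI| |exact: setISS].
    have := mean_setUI meanm oX oY; have := mean_le1 meanm (lunifU oX oY).
    by have := mean_le1 meanm (lunifI oX oY); rewrite mX mY; lra.
  - by exists X; split=> //; apply: subset_trans AB.
have [W [ultraW FW]] := ultraFilterLemma FF.
exists W => // X oX WX; rewrite lt_neqAle m_ge0 // andbT eq_sym; apply/eqP => mX0.
have /FW WC : F (~` X).
  exists (~` X); split=> //; first exact: lunifC.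
  have := mean_setID meanm (@lunifT G) oX.
  by rewrite mT setTI setTD mX0 add0r => <-.
by have [x []] := filter_ex (filterI WX WC).
Qed.

(** Let [w] be in the smallest intersection of stars, and [p] the set of the
    left uniformly open members of a wide ultrafilter. By [generic_chain], [w]
    is in the star of [divset (mulset X X)] for all [X] in [p], so that by
    compactness [w = x1 * x2 * x4^-1 * x3^-1] where all the factors are in the
    stars of all [X] in [p]. Such points are in a single coset of [H]: up to
    infinitesimals they have the same type over [M]. As [H] is normal, it
    contains [w]. *)
Lemma G00top_sub (R : realType) : has_open_subgroup_basis G -> amenable R G ->
  G00top D K j `<=` G000top D K j.
Proof.
move=> basisG /amenable_mean[m meanm] c cG H [[subH normH bH invH] muH].
have HG : H `<=` GstarD by case: subH.
have groupH : gsubgroup (H \o coord) by exact/star_subgroupP.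
have [H1 HD] := groupH.
have HV (z : gst) : H (coord z) -> H (coord (z^-1)%g).
  by move=> Hz; have := HD _ _ Hz H1; rewrite /= mulg1.
have HM (x y : gst) : H (coord x) -> H (coord y) -> H (coord (x * y)%g).
  by move=> /HV Hx /(HD _ _ Hx); rewrite /= invgK.
have HJ := (star_normalP elj HG).1 normH.
have [W ultraW Wm] := wide_ultrafilter meanm.
pose p : set (set G) := [set X | lunif X /\ W X].
have p0 : p !=set0 by exists setT; split; [exact: lunifT|exact: filterT].
have pI X Y : p X -> p Y -> p (X `&` Y).
  by move=> [oX WX] [oY WY]; split; [exact: lunifI|exact: filterI].
pose inv_ (X : set G) : set G := [set x | X (x^-1)%g].
have divE X : lunif X ->
    divset (mulset X X) = mulset (mulset X X) (inv_ (mulset X X)).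
  move=> oX; apply/seteqP; split=> _ [x Xx [y Xy <-]].
    by exists x => //; exists (y^-1)%g => //; rewrite /inv_ /= invgK.
  by exists x => //; exists (y^-1)%g => //; rewrite invgK.
have mT : (0 < m setT)%R by case: meanm => ->.
have Gc : GstarD c.
  have [Q [QP genQ Qmul _]] := generic_chain meanm (@lunifT G) mT.
  apply: (star_Gstar elj (U := Q 0)); last exact: (G00top_chain QP genQ Qmul).
  by have [/lunif_open] := QP 0.
have [w wc] := gcoord_surj elj Gc; subst c.
have wdiv X : p X -> st (divset (mulset X X)) w.
  move=> [oX WX]; have mX := Wm _ oX WX.
  have [Q [QP genQ Qmul Q0]] := generic_chain meanm oX mX.
  have oQ : open (Q 0) by have [/lunif_open] := QP 0.
  apply: (st_sub oQ _ Q0); last exact: (G00top_chain QP genQ Qmul).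
  by rewrite divE //; apply/lunif_open/lunif_mulset/lunif_mulset.
have mulset_mono X Y : X `<=` Y -> mulset X X `<=` mulset Y Y.
  by move=> XY; apply: mulset_sub.
have [y yP] : exists y, forall X, p X ->
    st (mulset X X) y /\ st (inv_ (mulset X X)) (y^-1 * w)%g.
  apply: (st_bigcap_mulset limK smallM satC
    (E := fun X => divset (mulset X X)) p0 pI) => //.
  - move=> X [oX _]; split; rewrite ?divE //.
    + exact/lunif_open/lunif_mulset.
    + exact/open_inv/lunif_open/lunif_mulset.
    + exact/lunif_open/lunif_mulset/lunif_mulset.
  - by move=> X Y XY; split; [exact: mulset_mono|move=> g; exact: mulset_mono].
  - by move=> X [oX _]; rewrite divE.
have split2 z : (forall X, p X -> st (mulset X X) z) ->
    exists u v, (u * v)%g = z /\ forall X, p X -> st X u /\ st X v.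
  move=> zP; have [u uP] : exists u, forall X, p X -> st X u /\ st X (u^-1 * z)%g.
    apply: (st_bigcap_mulset limK smallM satC (A := id) (B := id)
      (E := fun X => mulset X X) p0 pI) zP => [X [oX _]|X Y XY|X _ g //].
      by split; [exact: lunif_open|exact: lunif_open|exact/lunif_open/lunif_mulset].
    by split.
  by exists u, (u^-1 * z)%g; rewrite mulVKg.
have [x1 [x2 [x12 xP]]] := split2 y (fun X pX => (yP X pX).1).
have [x3 [x4 [x34 xP']]] : exists u v, (u * v)%g = (w^-1 * y)%g /\
    forall X, p X -> st X u /\ st X v.
  apply: split2 => X pX; have [oX _] := pX; have oXX := lunif_open (lunif_mulset X oX).
  have [_] := yP X pX => /(st_inv (open_inv oXX) oXX).
  by rewrite invgM invgK; apply.
have sameP (u v : gst) : (forall X, p X -> st X u) -> (forall X, p X -> st X v) ->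
    H (coord (u^-1 * v)%g).
  move=> uP vP.
  have uv X : lunif X -> st X u -> st X v.
    move=> oX Xu; have [WX|WC] := in_ultra_setVsetC X ultraW; first exact: vP.
    have oC := lunifC oX.
    exfalso; apply: (st_disjoint (lunif_open oX) (lunif_open oC) _ Xu
      (uP _ (conj oC WC))).
    by move=> g [].
  have [u' uu' mu] :=
    lunif_type_infinitesimal limK smallM satC basisG uv.
  have Huu' := same_type_coset limK smallM satC groupH
    (invariant_type_invariant invH) (bounded_index_small elj subH bH) uu'.
  have : H (coord (v * u'^-1)%g).
    by apply: muH => U [oU U1]; exact: mu.
  move/(HJ (u^-1)%g) => Hv; have := HM _ _ Hv Huu'.
  by rewrite /= !invgK !mulgA mulgK mulgVK.
have {}xP : forall X, p X -> [/\ st X x1, st X x2, st X x3 & st X x4].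
  by move=> X pX; have [? ?] := xP X pX; have [? ?] := xP' X pX.
have H13 : H (coord (x3^-1 * x1)%g) by apply: sameP => X /xP[].
have H24 : H (coord (x4^-1 * x2)%g) by apply: sameP => X /xP[].
have -> : w = (x1 * ((x2 * (x4^-1 * x2) * x2^-1) * (x3^-1 * x1)) * x1^-1)%g.
  have -> : w = (y * (w^-1 * y)^-1)%g by rewrite invgM invgK mulVKg.
  rewrite -x34 -x12 invgM !mulgA mulgK.
  by rewrite mulgK.
exact: ((HJ x1 _).1 (HM _ _ ((HJ x2 _).1 H24) H13)).
Qed.

End Components.

Theorem theorem4p11 (R : realType) (G : topologicalGroupType)
    (L : language) (M : structure L) (D : definable_group M G)
    (K : Type) (C : structure L) (j : M -> C)
    (hausdorffG : hausdorff_space G)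
    (basisG : has_open_subgroup_basis G)
    (amenableG : amenable R G)
    (monsterC : monster K j) :
  G00top D K j = G000top D K j.
Proof.
apply/seteqP; split; first exact: (G00top_sub monsterC basisG amenableG).
exact: (G000top_sub monsterC).
Qed.
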